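(* Let $\mathcal V=\{V;\nu_1,\dots,\nu_n\}$ be a vector arrangement over $\Bbbk$ with associated hyperplane arrangement $\mathcal H$. The multiplication $m^T$ is compatible with all three gradings and makes $(\mathcal C^T,\partial^T)$ into a triply-graded differential graded algebra. As a result, $H_\partial^{T\bullet}(\mathcal H)$ is a triply-graded algebra.
   Context: Let $\Bbbk$ be a field of characteristic zero. A vector arrangement $\mathcal V=\{V;\nu_1,\dots,\nu_n\}$ is a finite-dimensional $\Bbbk$-vector space $V$ with an inner product together with a list of vectors $\nu_i\in V$ (zero allowed). The associated hyperplane arrangement is $\mathcal H=\{V;H_1,\dots,H_n\}$, $H_i=\nu_i^\perp$. For $S\subseteq[n]=\{1,\dots,n\}$ put $H_S=\bigcap_{s\in S}H_s$ ($H_\emptyset=V$), $W=\{w\in\Bbbk^n:\sum_iw_i\nu_i=0\}$ with the inner product induced from the standard one on $\Bbbk^n$, and $W_S=\{w\in W:w_r=0\text{ for }r\notin S\}$. The inner products are understood to restrict non-degenerately to all subspaces onto which orthogonal projections are taken. $\mathcal C^T=\bigoplus_{S\subseteq[n]}\bigwedge^\bullet H_S\otimes\bigwedge^\bullet W_S$ with $\deg(\bigwedge^iH_S\otimes\bigwedge^jW_S)=(|S|+i,\,i,\,j)$. The differential is $\partial^T=\bigoplus_{S,\,s\in S}w_{S,s}\otimes b_{S,s}$, where $w_{S,s}:\bigwedge^\bullet H_S\to\bigwedge^{\bullet+1}H_{S-s}$ is inclusion followed by left wedging with the orthogonal projection of $\nu_s$ to $H_{S-s}$, and $b_{S,s}:\bigwedge^\bullet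 W_S\to\bigwedge^\bullet W_{S-s}$ is induced by orthogonal projection. It has degree $(0,1,0)$; the second degree is homological. $H_\partial^{T\bullet}(\mathcal H)$ is its homology. Multiplication $m^T:(\bigwedge^{i_1}H_S\otimes\bigwedge^{j_1}W_S)\otimes(\bigwedge^{i_2}H_T\otimes\bigwedge^{j_2}W_T)\to\bigwedge^{i_1+i_2}H_{S\cup T}\otimes\bigwedge^{j_1+j_2}W_{S\cup T}$: it is $0$ if $S\cap T\ne\emptyset$, and if $S\cap T=\emptyset$ then $m^T((h_1\otimes w_1)\otimes(h_2\otimes w_2))=(h_1\wedge h_2)\otimes(w_1\wedge w_2)$, where $h_1,h_2$ are sent to $\bigwedge^\bullet H_{S\cup T}$ by orthogonal projection and $w_1,w_2$ to $\bigwedge^\bullet W_{S\cup T}$ by inclusion. Compatibility with the differential means $\partial^T(m^T(a\otimes b))=m^T(\partial^Ta\otimes b)+(-1)^{i_1}m^T(a\otimes\partial^Tb)$ for $a\in\bigwedge^{i_1}H_S\otimes\bigwedge^{j_1}W_S$. *)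

(* Defs.v *)
From HB Require Import structures.
From mathcomp Require Import all_boot all_order all_algebra.
From mathcomp Require Import sesquilinear ring_quotient generic_quotient.

Set Implicit Arguments.
Unset Strict Implicit.
Unset Printing Implicit Defensive.

Import GRing.Theory.
Local Open Scope ring_scope.

(* A (x) B is modelled by coordinate matrices in the bases vbasis {:A} and    *)
(* vbasis {:B}; a (x) b is the rank one matrix of products of coordinates.    *)
Section Tensor.
Variables (K : fieldType) (A B : vectType K).

Definition tensor := 'M[K]_(\dim {:A}, \dim {:B}).

Definition tens (a : A) (b : B) : tensor :=
  \matrix_(i, j) (coord (vbasis {:A}) i a * coord (vbasis {:B}) j b).

(* The linear map A (x) B -> C induced by a bilinear f : A -> B -> C. *)
Definition tlift (C : lmodType K) (f : A -> B -> C) (x : tensor) : C :=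
  \sum_i \sum_j x i j *: f (vbasis {:A})`_i (vbasis {:B})`_j.

Definition tensv (U : {vspace A}) (U' : {vspace B}) : {vspace tensor} :=
  <<[seq tens a b | a <- vbasis U, b <- vbasis U']>>%VS.

Lemma tlift_is_linear (C : lmodType K) (f : A -> B -> C) : linear (tlift f).
Proof.
move=> c x y; rewrite /tlift scaler_sumr -big_split; apply: eq_bigr => i _.
rewrite scaler_sumr -big_split; apply: eq_bigr => j _.
by rewrite !mxE scalerDl scalerA.
Qed.
HB.instance Definition _ (C : lmodType K) (f : A -> B -> C) :=
  GRing.isLinear.Build K tensor C *:%R (tlift f) (tlift_is_linear f).

End Tensor.

(* The exterior algebra of U on the basis e_0, ..., e_(d-1) := vbasis {:U}:   *)
(* x I is the coordinate of x on e_I, the wedge of the e_i for i in I, taken  *)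
(* in increasing order.                                                       *)
Section Exterior.
Variables (K : fieldType) (U : vectType K).

Definition ext := {ffun {set 'I_(\dim {:U})} -> K^o}.

Definition ext_basis (I : {set 'I_(\dim {:U})}) : ext :=
  [ffun J => (J == I)%:R : K^o].

Definition ext1 : ext := ext_basis set0.

Definition extv (u : U) : ext :=
  \sum_i coord (vbasis {:U}) i u *: ext_basis [set i].

Definition inversions (I J : {set 'I_(\dim {:U})}) : nat :=
  #|[set p in setX I J | (p.2 < p.1)%N]|.

Definition wedge (x y : ext) : ext :=
  \sum_(I : {set _}) \sum_(J : {set _} | [disjoint I & J])
     ((x I : K) * y J * (-1) ^+ inversions I J) *: ext_basis (I :|: J).

Definition extp (i : nat) : {vspace ext} :=
  <<[seq ext_basis J | J <- enum [set J : {set 'I_(\dim {:U})} | #|J| == i]]>>%VS.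

End Exterior.

(* The algebra map /\U -> /\U' induced by a linear f : U -> U'. *)
Definition ext_map (K : fieldType) (U U' : vectType K) (f : U -> U')
    (x : ext U) : ext U' :=
  \sum_I (x I : K) *:
     \big[@wedge K U'/ext1 U']_(i <- enum I) extv (f (vbasis {:U})`_i).

Section DirectSum.
Variables (K : fieldType) (I : finType) (T : I -> vectType K).

Definition dsum := {dffun forall i, T i}.
HB.instance Definition _ := Choice.on dsum.
Implicit Types f g : dsum.

Definition dsum_of (f : forall i, T i) : dsum := [ffun i => f i].

Lemma dsum_ofE f i : dsum_of f i = f i.
Proof. by rewrite ffunE. Qed.

Definition dsum_add f g := dsum_of (fun i => f i + g i).
Definition dsum_opp f := dsum_of (fun i => - f i).
Definition dsum_scale (c : K) f := dsum_of (fun i => c *: f i).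

Fact dsum_addA : associative dsum_add.
Proof. by move=> f g h; apply/ffunP=> i; rewrite !ffunE addrA. Qed.
Fact dsum_addC : commutative dsum_add.
Proof. by move=> f g; apply/ffunP=> i; rewrite !ffunE addrC. Qed.
Fact dsum_add0 : left_id (dsum_of (fun=> 0)) dsum_add.
Proof. by move=> f; apply/ffunP=> i; rewrite !ffunE add0r. Qed.
Fact dsum_addN : left_inverse (dsum_of (fun=> 0)) dsum_opp dsum_add.
Proof. by move=> f; apply/ffunP=> i; rewrite !ffunE addNr. Qed.
HB.instance Definition _ :=
  GRing.isZmodule.Build dsum dsum_addA dsum_addC dsum_add0 dsum_addN.

Fact dsum_scaleA c c' f : dsum_scale c (dsum_scale c' f) = dsum_scale (c * c') f.
Proof. by apply/ffunP=> i; rewrite !ffunE scalerA. Qed.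
Fact dsum_scale1 : left_id 1 dsum_scale.
Proof. by move=> f; apply/ffunP=> i; rewrite !ffunE scale1r. Qed.
Fact dsum_scaleDr : right_distributive dsum_scale +%R.
Proof. by move=> c f g; apply/ffunP=> i; rewrite !ffunE scalerDr. Qed.
Fact dsum_scaleDl f : {morph dsum_scale^~ f : c c' / c + c'}.
Proof. by move=> c c'; apply/ffunP=> i; rewrite !ffunE scalerDl. Qed.
HB.instance Definition _ := GRing.Zmodule_isLmodule.Build K dsum
  dsum_scaleA dsum_scale1 dsum_scaleDr dsum_scaleDl.

Lemma dsumD f g i : (f + g) i = f i + g i. Proof. exact: ffunE. Qed.
Lemma dsumZ c f i : (c *: f) i = c *: f i. Proof. exact: ffunE. Qed.

Let J : finType := {i : I & 'I_(\dim {:T i})}.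

Fact dsum_vect_iso : Vector.axiom #|J| dsum.
Proof.
pose v2r f : 'rV_#|J| :=
  \row_k (coord (vbasis {:T (tag (enum_val k : J))}) (tagged (enum_val k : J))
                (f (tag (enum_val k : J)))).
pose r2v (r : 'rV[K]_#|J|) : dsum := dsum_of (fun i =>
  \sum_(j < \dim {:T i}) r 0 (enum_rank (Tagged _ j : J)) *: (vbasis {:T i})`_j).
exists v2r.
  by move=> c f g; apply/rowP=> k; rewrite !mxE dsumD dsumZ linearP.
exists r2v => [f|r].
  apply/ffunP=> i; rewrite [LHS]ffunE [RHS](coord_vbasis (memvf _)).
  by apply: eq_bigr => j _; rewrite mxE enum_rankK.
apply/rowP=> k; rewrite mxE [X in coord _ _ X]ffunE coord_sum_free ?(basis_free (vbasisP _)) //.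
by congr (r 0 _); rewrite -[RHS]enum_valK; case: (enum_val k).
Qed.
HB.instance Definition _ := Lmodule_hasFinDim.Build K dsum dsum_vect_iso.

End DirectSum.

Section GradedStructures.
Variables (K : fieldType) (A : lmodType K).
Variable (G : nat -> nat -> nat -> A -> Prop).

(* A is the direct sum of its subspaces G p q r. *)
Record is_trigrading : Prop := {
  trigr_submod p q r :
    G p q r 0 /\ (forall c x y, G p q r x -> G p q r y -> G p q r (c *: x + y));
  trigr_sum x : exists N (c : nat -> nat -> nat -> A),
    (forall p q r, G p q r (c p q r)) /\
    x = \sum_(p < N) \sum_(q < N) \sum_(r < N) c p q r;
  trigr_direct N (c : nat -> nat -> nat -> A) :
    (forall p q r, G p q r (c p q r)) ->
    \sum_(p < N) \sum_(q < N) \sum_(r < N) c p q r = 0 ->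
    forall p q r, (p < N)%N -> (q < N)%N -> (r < N)%N -> c p q r = 0
}.

Record is_trigraded_algebra (mul : A -> A -> A) (one : A) : Prop := {
  tga_grading : is_trigrading;
  tga_linearl y : linear (mul^~ y);
  tga_linearr x : linear (mul x);
  tga_assoc : associative mul;
  tga_unitl : left_id one mul;
  tga_unitr : right_id one mul;
  tga_deg_one : G 0 0 0 one;
  tga_deg_mul p q r p' q' r' x y : G p q r x -> G p' q' r' y ->
    G (p + p') (q + q') (r + r') (mul x y)
}.

(* The second degree is the homological one. *)
Record is_tridga (mul : A -> A -> A) (one : A) (d : A -> A) : Prop := {
  tdga_algebra : is_trigraded_algebra mul one;
  tdga_linear : linear d;
  tdga_deg p q r x : G p q r x -> G p q.+1 r (d x);
  tdga_sq x : d (d x) = 0;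
  tdga_leibniz p q r x y : G p q r x ->
    d (mul x y) = mul (d x) y + (-1) ^+ q *: mul x (d y)
}.

End GradedStructures.

(* ker d / im d; boundary is im d seen inside ker d. *)
Section Homology.
Variables (K : fieldType) (A : vectType K) (d : 'End(A)).

Definition cycle_space := subvs_of (lker d).

Definition boundary : {pred cycle_space} := fun z => vsval z \in limg d.

Lemma boundaryE z : (z \in boundary) = (vsval z \in limg d).
Proof. by []. Qed.

Fact boundary_zmod_closed : zmod_closed boundary.
Proof.
split=> [|x y]; rewrite !boundaryE; first by rewrite linear0 mem0v.
by move=> xB yB; rewrite linearB memvB.
Qed.
HB.instance Definition _ := GRing.isZmodClosed.Build cycle_space boundary
  boundary_zmod_closed.

Definition homology := Quotient.quot boundary.
HB.instance Definition _ := GRing.Zmodule.on homology.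

Definition hclass (z : cycle_space) : homology := (\pi_homology z)%qT.

Definition hscale (c : K) (x : homology) : homology := hclass (c *: repr x).

Lemma hclass_eq z z' : (hclass z == hclass z') = (z - z' \in boundary).
Proof. by rewrite Quotient.idealrBE. Qed.

Lemma hclassK x : hclass (repr x) = x.
Proof. exact: reprK. Qed.

Lemma hclassD z z' : hclass (z + z') = hclass z + hclass z'.
Proof. by rewrite /hclass !piE. Qed.

Lemma hclassZ c z : hclass (c *: z) = hscale c (hclass z).
Proof.
apply/eqP; rewrite hclass_eq -scalerBr boundaryE linearZ memvZ //.
by have /eqP := esym (hclassK (hclass z)); rewrite hclass_eq.
Qed.

Fact hscaleA c c' x : hscale c (hscale c' x) = hscale (c * c') x.
Proof. by rewrite -(hclassK x) -!hclassZ scalerA. Qed.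
Fact hscale1 : left_id 1 hscale.
Proof. by move=> x; rewrite -(hclassK x) -hclassZ scale1r. Qed.
Fact hscaleDr : right_distributive hscale +%R.
Proof.
move=> c x y; rewrite -(hclassK x) -(hclassK y).
by rewrite -hclassD -!hclassZ -hclassD scalerDr.
Qed.
Fact hscaleDl x : {morph hscale^~ x : c c' / c + c'}.
Proof. by move=> c c'; rewrite -(hclassK x) -!hclassZ -hclassD scalerDl. Qed.
HB.instance Definition _ := GRing.Zmodule_isLmodule.Build K homology
  hscaleA hscale1 hscaleDr hscaleDl.

End Homology.

Section StandardForm.
Variables (K : fieldType) (n : nat).

Definition stdform (u v : 'rV[K]_n) : K := \sum_i u 0 i * v 0 i.

Fact stdform_linearl v : linear_for *%R (stdform^~ v).
Proof.
move=> c u u'; rewrite /stdform mulr_sumr -big_split.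
by apply: eq_bigr => i _; rewrite !mxE mulrDl mulrA.
Qed.
Fact stdform_sym u v : stdform u v = (-1) ^+ false * idfun (stdform v u).
Proof. by rewrite mul1r; apply: eq_bigr => i _; rewrite mulrC. Qed.
Fact stdform_linearr u : linear_for (idfun \; *%R) (stdform u).
Proof.
move=> c v v'; rewrite !(stdform_sym u) !mul1r /= stdform_linearl.
by [].
Qed.
HB.instance Definition _ := bilinear_isBilinear.Build K 'rV[K]_n 'rV[K]_n K
  *%R (idfun \; *%R) stdform (stdform_linearl, stdform_linearr).
HB.instance Definition _ := isHermitianSesquilinear.Build K 'rV[K]_n
  false idfun stdform stdform_sym.

End StandardForm.

(* Orthogonal projection onto U; meaningful when f is non-degenerate on U, in *)
(* which case the ambient space is the direct sum of U and orthov f U.        *)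
Section Orthogonal.
Variables (K : fieldType) (V : vectType K) (f : {symmetric V}).

Definition nondegenerate_on (U : {vspace V}) : Prop :=
  (U :&: orthov f U)%VS = 0%VS.

Definition oproj (U : {vspace V}) (v : V) : V := daddv_pi U (orthov f U) v.

End Orthogonal.

Section Arrangement.
Variables (K : fieldType) (V : vectType K) (form : {symmetric V}).
Variables (n : nat) (nu : 'I_n -> V).
Implicit Types S T R : {set 'I_n}.

Definition Hsp S : {vspace V} := (\bigcap_(s in S) orthov form <[nu s]>)%VS.

Lemma mem_Hsp S v :
  reflect (forall s, s \in S -> form v (nu s) = 0) (v \in Hsp S).
Proof.
rewrite /Hsp memvE; apply: (iffP subv_bigcapP) => h s /h.
  by rewrite -memvE mem_orthov1 => /eqP.
by rewrite -memvE mem_orthov1 => ->.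
Qed.

Definition nu_comb (w : 'rV[K]_n) : V := \sum_i w 0 i *: nu i.

Fact nu_comb_linear : linear nu_comb.
Proof.
move=> c u v; rewrite /nu_comb scaler_sumr -big_split; apply: eq_bigr => i _.
by rewrite !mxE scalerDl scalerA.
Qed.
HB.instance Definition _ :=
  GRing.isLinear.Build K 'rV[K]_n V *:%R nu_comb nu_comb_linear.

Definition row_coord (r : 'I_n) (w : 'rV[K]_n) : K^o := w 0 r.

Fact row_coord_linear r : linear (row_coord r).
Proof. by move=> c u v; rewrite /row_coord !mxE. Qed.
HB.instance Definition _ r :=
  GRing.isLinear.Build K 'rV[K]_n K^o *:%R (row_coord r) (row_coord_linear r).

Definition Wsp S : {vspace 'rV[K]_n} :=
  (lker (linfun nu_comb) :&:
     \bigcap_(r | r \notin S) lker (linfun (row_coord r)))%VS.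

Lemma mem_Wsp S (w : 'rV[K]_n) :
  reflect (\sum_i w 0 i *: nu i = 0 /\ forall r, r \notin S -> w 0 r = 0)
          (w \in Wsp S).
Proof.
rewrite memv_cap memv_ker lfunE; apply: (iffP andP) => -[h1 h2]; split.
- exact/eqP.
- move=> r rS; move: h2; rewrite memvE => /subv_bigcapP/(_ r rS).
  by rewrite -memvE memv_ker lfunE => /eqP.
- exact/eqP.
rewrite memvE; apply/subv_bigcapP => r rS; rewrite -memvE memv_ker lfunE.
exact/eqP/h2.
Qed.

Definition HS S := subvs_of (Hsp S).
Definition WS S := subvs_of (Wsp S).

(* vsproj U is a retraction onto the subtype subvs_of U; it is only applied   *)
(* below to vectors of U.                                                     *)
Definition Hincl S R (h : HS S) : HS R := vsproj (Hsp R) (vsval h).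
Definition Hproj S R (h : HS S) : HS R :=
  vsproj (Hsp R) (oproj form (Hsp R) (vsval h)).
Definition Wincl S R (w : WS S) : WS R := vsproj (Wsp R) (vsval w).
Definition Wproj S R (w : WS S) : WS R :=
  vsproj (Wsp R) (oproj (@stdform K n) (Wsp R) (vsval w)).

Definition CS S := tensor (ext (HS S)) (ext (WS S)).
Definition CT := dsum CS.

Definition CTdeg (p q r : nat) (a : CT) : Prop := forall S,
  a S \in (if (#|S| + q == p)%N then tensv (extp (HS S) q) (extp (WS S) r)
           else 0%VS).

(* In wmap, bmap and mCS the target index R is a separate argument, to be     *)
(* instantiated at R = S :\ s, respectively R = S :|: T.                      *)
Definition wmap S (s : 'I_n) R (h : ext (HS S)) : ext (HS R) :=
  wedge (extv (vsproj (Hsp R) (oproj form (Hsp R) (nu s)) : HS R))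
        (ext_map (@Hincl S R) h).

Definition bmap S R : ext (WS S) -> ext (WS R) := ext_map (@Wproj S R).

Definition dCS S s R : CS S -> CS R :=
  tlift (fun h w => tens (wmap s R h) (bmap R w) : CS R).

Definition dCT_fun (a : CT) : CT := dsum_of (fun R =>
  \sum_(S : {set 'I_n}) \sum_(s in S | S :\ s == R) dCS s R (a S)).

Lemma dCT_funE a R : dCT_fun a R =
  \sum_(S : {set 'I_n}) \sum_(s in S | S :\ s == R) dCS s R (a S).
Proof. exact: ffunE. Qed.

Fact dCT_linear : linear dCT_fun.
Proof.
move=> c a b; apply/ffunP=> R; rewrite dsumD dsumZ !dCT_funE.
rewrite scaler_sumr -big_split; apply: eq_bigr => S _.
rewrite scaler_sumr -big_split; apply: eq_bigr => s _.
by rewrite dsumD dsumZ /dCS linearP.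
Qed.
HB.instance Definition _ :=
  GRing.isLinear.Build K CT CT *:%R dCT_fun dCT_linear.

Definition dCT : 'End(CT) := linfun dCT_fun.

Definition mCS S T R (x : CS S) (y : CS T) : CS R :=
  tlift (fun h1 w1 =>
    tlift (fun h2 w2 =>
      tens (wedge (ext_map (@Hproj S R) h1) (ext_map (@Hproj T R) h2))
           (wedge (ext_map (@Wincl S R) w1) (ext_map (@Wincl T R) w2)) : CS R)
    y) x.

(* Pairs S, T that are not disjoint multiply to 0, hence do not occur. *)
Definition mCT (a b : CT) : CT := dsum_of (fun R =>
  \sum_(S : {set 'I_n})
    \sum_(T : {set 'I_n} | [disjoint S & T] && (S :|: T == R))
      mCS R (a S) (b T)).

Definition oneCT : CT := dsum_of (fun S =>
  if S == set0 then tens (ext1 (HS S)) (ext1 (WS S)) : CS S else 0).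

Definition HCT := homology dCT.

Definition HCTdeg (p q r : nat) (x : HCT) : Prop :=
  exists2 z : cycle_space dCT, CTdeg p q r (vsval z) & x = hclass z.

End Arrangement.

(* Main.v *)
Require Import Defs.
From HB Require Import structures.
From mathcomp Require Import all_boot all_order all_algebra.
From mathcomp Require Import sesquilinear.

Set Implicit Arguments.
Unset Strict Implicit.
Unset Printing Implicit Defensive.

Import GRing.Theory.
Local Open Scope ring_scope.

(** Every identity is checked on the elements [h (x) w] of one summand
    [/\ H_S (x) /\ W_S], on which product and differential are explicit, and
    [h] is built from [1] by wedging vectors on the left.  For these reductions
    one needs that the wedge product is associative, that [ext_map] of a linear
    map is an algebra morphism, functorially in the map, and that orthogonal
    projections to nested non-degenerate subspaces compose.

    Write [p_R] for the projection to [H_R].  For [t] in [R] the space [H_R]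
    is the subspace of [H_(R - t)] orthogonal to [p_(R - t) (nu_t)], so [p_R x]
    and [p_(R - t) x] differ by a multiple of this vector.  After wedging with it
    the two projections agree.

    - The square of the differential: for [R = S - s - t] the two ways of
      removing [s] and [t] give the wedge of [p_R (nu_s)] and [p_R (nu_t)] in the
      two orders, tensored with the same projection of relations, and cancel.

    - The Leibniz rule: let [u] be removed from [S U T], leaving [R].  On both
      sides the corresponding terms carry the factor [p_R (nu_u)].  If it is zero there is nothing to
      prove.  If not, pairing a relation on [S U T] with vectors of [H_R] shows
      that its coordinate at [u] vanishes.  All relations in sight then already
      live on [R], and the projections of relations are identities, which is
      what makes them multiplicative.  In general they are not.  When [S] and [T]
      meet, the product is zero, and the surviving terms of the right-hand side
      have [S] and [T] meeting in [u] alone; the factor [p_R (nu_u)] is then zero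
      because [u] is in [R].

    The trigrading is given by projectors [CT_part], which commute with the
    differential up to the shift of the homological degree.  They therefore
    descend to homology, where they again give a trigrading; homogeneous
    components of cycles are cycles, and with the Leibniz rule for homogeneous
    elements this makes the product descend to homology as well. *)

(** * The exterior algebra *)

Lemma disjoints_Ul (T : finType) (A B C : {set T}) :
  [disjoint A :|: B & C] = [disjoint A & C] && [disjoint B & C].
Proof. by rewrite -!setI_eq0 setIUl setU_eq0. Qed.

Lemma disjoints_Ur (T : finType) (A B C : {set T}) :
  [disjoint A & B :|: C] = [disjoint A & B] && [disjoint A & C].
Proof. by rewrite -!setI_eq0 setIUr setU_eq0. Qed.

Section ExteriorAlgebra.
Variables (K : fieldType) (U : vectType K).
Local Notation d := (\dim {:U}).
Implicit Types (u v : U) (x y z : ext U) (I J L : {set 'I_d}).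

Fact wedge_bilinear : bilinear_for
  (GRing.Scale.Law.clone _ _ *:%R _) (GRing.Scale.Law.clone _ _ *:%R _)
  (@wedge K U).
Proof.
split=> [y|x] c u v /=; rewrite /wedge scaler_sumr -big_split /=;
  apply: eq_bigr => I _; rewrite scaler_sumr -big_split /=;
  apply: eq_bigr => J _; rewrite !ffunE scalerA -scalerDl; congr (_ *: _).
  by rewrite !mulrDl !mulrA.
by rewrite mulrDr mulrDl !mulrA [x I * _]mulrC.
Qed.
HB.instance Definition _ := bilinear_isBilinear.Build K (ext U) (ext U) (ext U)
  _ _ (@wedge K U) wedge_bilinear.

Fact extv_is_linear : linear (@extv K U).
Proof.
move=> c u v; rewrite /extv scaler_sumr -big_split; apply: eq_bigr => i _.
by rewrite linearP scalerDl scalerA.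
Qed.
HB.instance Definition _ :=
  GRing.isLinear.Build K U (ext U) *:%R (@extv K U) extv_is_linear.

Lemma ext_coord x : x = \sum_J (x J : K) *: ext_basis J.
Proof.
apply/ffunP => J; rewrite sum_ffunE (bigD1 J) //= big1 => [|I /negPf nIJ].
  by rewrite addr0 !ffunE eqxx /GRing.scale /= mulr1.
by rewrite !ffunE eq_sym nIJ scaler0.
Qed.

Lemma ext_basis_ind (P : ext U -> Prop) :
  (forall c x y, P x -> P y -> P (c *: x + y)) ->
  (forall J, P (ext_basis J)) -> forall x, P x.
Proof.
move=> PD Pb x; rewrite (ext_coord x); apply: big_ind => [|y z Py Pz|J _].
- by rewrite -(addNr (ext_basis set0)) -scaleN1r; apply: PD.
- by rewrite -[y]scale1r; apply: PD.
rewrite -[_ *: _]addr0; apply: (PD) => //.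
by rewrite -(addNr (ext_basis set0)) -scaleN1r; apply: PD.
Qed.

Lemma wedge_basis I J : wedge (ext_basis I) (ext_basis J) =
  if [disjoint I & J] then ((-1) ^+ inversions I J : K) *: ext_basis (I :|: J)
  else 0.
Proof.
rewrite /wedge (bigD1 I) //= [X in _ + X]big1 ?addr0 => [|I' /negPf nI]; last first.
  by apply: big1 => J' _; rewrite !ffunE nI !mul0r scale0r.
case: ifP => IJ; last first.
  rewrite big1 // => J' dJ; rewrite !ffunE (negPf (_ : J' != J)) ?mulr0 ?mul0r ?scale0r //.
  by apply: contraFN IJ => /eqP <-.
rewrite (bigD1 J) //= big1 ?addr0 => [|J' /andP[_ /negPf nJ]].
  by rewrite !ffunE !eqxx !mul1r.
by rewrite !ffunE nJ mulr0 mul0r scale0r.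
Qed.

(** Additivity in both arguments gives the cocycle condition on signs that
    associativity of the wedge product needs. *)
Lemma inversionsUl I J L : [disjoint I & J] ->
  inversions (I :|: J) L = (inversions I L + inversions J L)%N.
Proof.
move=> dIJ; rewrite /inversions -cardsUI [X in (_ + X)%N]eq_card0 => [|p]; last first.
  rewrite !inE; apply: contraTF dIJ => /andP[/andP[/andP[pI _] _] /andP[/andP[pJ _] _]].
  by apply/pred0Pn; exists p.1; rewrite /= pI.
by rewrite addn0; apply: eq_card => p; rewrite !inE -andb_orl -andb_orl.
Qed.

Lemma inversionsUr I J L : [disjoint J & L] ->
  inversions I (J :|: L) = (inversions I J + inversions I L)%N.
Proof.
move=> dIJ; rewrite /inversions -cardsUI [X in (_ + X)%N]eq_card0 => [|p]; last first.
  rewrite !inE; apply: contraTF dIJ => /andP[/andP[/andP[_ pI] _] /andP[/andP[_ pJ] _]].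
  by apply/pred0Pn; exists p.2; rewrite /= pI.
by rewrite addn0; apply: eq_card => p; rewrite !inE -andb_orl -andb_orr.
Qed.

Lemma wedgeA x y z : wedge x (wedge y z) = wedge (wedge x y) z.
Proof.
elim/ext_basis_ind: x => [c x x' IH IH'|I]; first by rewrite !linearPl /= IH IH'.
elim/ext_basis_ind: y => [c y y' IH IH'|J].
  by rewrite linearPl !linearPr linearPl /= IH IH'.
elim/ext_basis_ind: z => [c z z' IH IH'|L]; first by rewrite !linearPr /= IH IH'.
rewrite !wedge_basis; case: ifP => dJL; case: ifP => dIJ;
  rewrite ?linear0r ?linear0l ?linearZr_LR ?linearZl_LR /= ?wedge_basis //.
- rewrite disjoints_Ul disjoints_Ur dIJ dJL /= andbT.
  case: ifP => dIL; last by rewrite !scaler0.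
  rewrite !scalerA -!exprD inversionsUl // inversionsUr // setUA.
  by rewrite [(inversions J L + _)%N]addnC addnA.
- by rewrite disjoints_Ur dIJ /= scaler0.
- by rewrite disjoints_Ul dJL andbF scaler0.
Qed.

Lemma wedge1x : left_id (ext1 U) (@wedge K U).
Proof.
move=> x; elim/ext_basis_ind: x => [c x x' IH IH'|I]; first by rewrite linearPr /= IH IH'.
rewrite wedge_basis -setI_eq0 set0I eqxx set0U /inversions eq_card0 ?scale1r // => p.
by rewrite !inE.
Qed.

Lemma wedgex1 : right_id (ext1 U) (@wedge K U).
Proof.
move=> x; elim/ext_basis_ind: x => [c x x' IH IH'|I]; first by rewrite linearPl /= IH IH'.
rewrite wedge_basis -setI_eq0 setI0 eqxx setU0 /inversions eq_card0 ?scale1r // => p.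
by rewrite !inE andbF.
Qed.

Lemma coord_vbasisT (i j : 'I_d) : coord (vbasis {:U}) i (vbasis {:U})`_j = (j == i)%:R.
Proof. by rewrite coord_free ?(basis_free (vbasisP _)). Qed.

Lemma extv_vbasis (i : 'I_d) : extv (vbasis {:U})`_i = ext_basis [set i].
Proof.
rewrite /extv (bigD1 i) //= coord_vbasisT eqxx scale1r big1 ?addr0 // => j /negPf nji.
by rewrite coord_vbasisT eq_sym nji scale0r.
Qed.

Lemma vbasis_ind (P : U -> Prop) :
  (forall c u v, P u -> P v -> P (c *: u + v)) ->
  P 0 -> (forall i : 'I_d, P (vbasis {:U})`_i) -> forall u, P u.
Proof.
move=> PD P0 Pb u; rewrite (coord_vbasis (memvf u)).
apply: big_ind => [//|v w Pv Pw|i _]; first by rewrite -[v]scale1r; apply: PD.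
by rewrite -[_ *: _]addr0; apply: PD.
Qed.

Lemma wedge_extvC u v : wedge (extv u) (extv v) = - wedge (extv v) (extv u).
Proof.
elim/vbasis_ind: u => [c u u' IH IH'||i].
- by rewrite [extv (_ + _)]linearP linearPl linearPr /= IH IH' scalerN opprD.
- by rewrite [extv 0]linear0 linear0l linear0r oppr0.
elim/vbasis_ind: v => [c v v' IH IH'||j].
- by rewrite [extv (_ + _)]linearP linearPl linearPr /= IH IH' scalerN opprD.
- by rewrite [extv 0]linear0 linear0l linear0r oppr0.
rewrite !extv_vbasis !wedge_basis !disjoints1 !inE.
rewrite eq_sym; have [_|nij] := eqVneq i j; first by rewrite oppr0.
rewrite setUC -scaleNr; congr (_ *: _).
have inv1 (k l : 'I_d) : inversions [set k] [set l] = (l < k)%N.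
  rewrite /inversions; case: ltnP => lk.
    rewrite -[RHS](cards1 (k, l)); apply: eq_card => -[p q].
    by rewrite !inE /= xpair_eqE; case: eqP => //= ->; case: eqP => //= ->.
  rewrite eq_card0 // => -[p q]; rewrite !inE /=.
  by case: eqP => //= ->; case: eqP => //= ->; rewrite ltnNge lk.
rewrite !inv1; move: nij; rewrite -val_eqE neq_ltn => /orP[] lt.
  by rewrite lt ltnNge ltnW //= expr0 expr1 ?opprK.
by rewrite lt ltnNge ltnW //= expr0 expr1 ?opprK.
Qed.

(** By anticommutativity the square of a sum is the sum of the squares, which
    reduces the claim to basis vectors. *)
Lemma wedge_extvv u : wedge (extv u) (extv u) = 0.
Proof.
elim/vbasis_ind: u => [c u v IHu IHv||i].
- rewrite [extv (_ + _)]linearP linearPl !linearPr /= IHu IHv wedge_extvC.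
  by rewrite scaler0 add0r addr0 scalerN addNr.
- by rewrite [extv 0]linear0 linear0l.
by rewrite extv_vbasis wedge_basis disjoints1 !inE eqxx.
Qed.

Lemma wedge_extvvA u x : wedge (extv u) (wedge (extv u) x) = 0.
Proof. by rewrite wedgeA wedge_extvv linear0l. Qed.

Lemma wedge_extvCA u v x :
  wedge (extv u) (wedge (extv v) x) = - wedge (extv v) (wedge (extv u) x).
Proof. by rewrite !wedgeA wedge_extvC linearNl. Qed.

(** Prepending an index below all those of [J] keeps the increasing enumeration
    of [J] in order, so that no sign appears. *)
Definition above (i : 'I_d) J := [forall j in J, (i < j)%N].

Lemma above_notin i J : above i J -> i \notin J.
Proof.
by move=> /forall_inP ij; apply/negP => /ij; rewrite ltnn.
Qed.

Lemma wedge_basis_above i J : above i J ->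
  wedge (ext_basis [set i]) (ext_basis J) = ext_basis (i |: J).
Proof.
move=> iJ; rewrite wedge_basis disjoints1 above_notin // /inversions.
rewrite eq_card0 ?scale1r // => -[p q]; rewrite !inE /=.
apply/negP => /andP[/andP[/eqP-> qJ]].
by rewrite ltnNge ltnW //; move/forall_inP: iJ; apply.
Qed.

Lemma enum_above i J : above i J -> enum (i |: J) = i :: enum J.
Proof.
move=> iJ.
have srt (A : {set 'I_d}) : sorted (fun k l : 'I_d => (k < l)%N) (enum A).
  have: sorted (relpre val ltn) (enum 'I_d).
    by rewrite -sorted_map val_enum_ord iota_ltn_sorted.
  rewrite [enum A]/enum_mem -enumT; apply: sorted_filter => k l m.
  exact: ltn_trans.
apply: (irr_sorted_eq (leT := fun k l : 'I_d => (k < l)%N)) => //.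
- by move=> k l m; apply: ltn_trans.
- by move=> k; rewrite ltnn.
- rewrite /= path_sortedE; last by move=> k l m; apply: ltn_trans.
  rewrite srt andbT; apply/allP => j; rewrite mem_enum.
  by move/forall_inP: iJ; apply.
by move=> j; rewrite !inE !mem_enum !inE.
Qed.

(** The case [i |: J] arises by removing the least index. *)
Lemma set_ind_above (P : {set 'I_d} -> Prop) :
  P set0 -> (forall i J, above i J -> P J -> P (i |: J)) -> forall J, P J.
Proof.
move=> P0 Pi J; have [k] := ubnP #|J|; elim: k J => // k IH J leJ.
have [->//|[j0 j0J]] := set_0Vmem J.
have [i iJ' imin] := arg_minnP (val : 'I_d -> nat) j0J.
have {iJ'}iJ : i \in J := iJ'.
rewrite -(setD1K iJ); apply: Pi.
  apply/forall_inP => j; rewrite !inE => /andP[ji jJ].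
  by rewrite ltn_neqAle imin // andbT eq_sym.
by apply: IH; move: leJ; rewrite (cardsD1 i J) iJ.
Qed.

(** The exterior algebra is generated by vectors: identities that are stable
    under wedging with a vector on the left need only be checked on [1]. *)
Lemma ext_ind (P : ext U -> Prop) :
  (forall c x y, P x -> P y -> P (c *: x + y)) -> P (ext1 U) ->
  (forall u x, P x -> P (wedge (extv u) x)) -> forall x, P x.
Proof.
move=> PD P1 Pu x; elim/ext_basis_ind: x => [//|J].
elim/set_ind_above: J => [//|i J iJ PJ].
by rewrite -wedge_basis_above // -extv_vbasis; apply: Pu.
Qed.

Lemma ext_basis_deg J : ext_basis J \in extp U #|J|.
Proof. by apply/memv_span/mapP; exists J; rewrite // mem_enum inE. Qed.

Lemma mem_extp q x :
  reflect (forall J, #|J| != q -> x J = 0) (x \in extp U q).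
Proof.
apply: (iffP idP) => [xq J Jq|x0].
  pose ev (y : ext U) : K^o := y J.
  have ev_lin : linear ev by move=> c y z; rewrite /ev !ffunE.
  pose evL : {linear ext U -> K^o} :=
    HB.pack ev (GRing.isLinear.Build K (ext U) K^o *:%R ev ev_lin).
  suff: (extp U q <= lker (linfun evL))%VS.
    by move/subvP/(_ _ xq); rewrite memv_ker lfunE => /eqP.
  apply/span_subvP => y /mapP[I]; rewrite mem_enum inE => /eqP Iq -> {y}.
  rewrite memv_ker lfunE /= /ev ffunE.
  by have [eJ|] := eqVneq J I; [rewrite eJ Iq eqxx in Jq | rewrite eqxx].
rewrite (ext_coord x); apply: memv_suml => J _.
have [<-|/x0 ->] := eqVneq #|J| q; last by rewrite scale0r mem0v.
exact/memvZ/ext_basis_deg.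
Qed.

(** The form of [ext_ind] for claims that mention the degree, such as signs. *)
Lemma extp_ind (P : nat -> ext U -> Prop) :
  (forall q c x y, P q x -> P q y -> P q (c *: x + y)) -> (forall q, P q 0) ->
  P 0%N (ext1 U) ->
  (forall q u x, x \in extp U q -> P q x -> P q.+1 (wedge (extv u) x)) ->
  forall q x, x \in extp U q -> P q x.
Proof.
move=> PD P0 P1 Pu q x /mem_extp x0; rewrite (ext_coord x).
apply: big_ind => [//|y z Py Pz|J _]; first by rewrite -[y]scale1r; apply: PD.
have [<-|/x0 ->] := eqVneq #|J| q; last by rewrite scale0r.
rewrite -[_ *: _]addr0; apply: PD => //.
elim/set_ind_above: {x x0 q}J => [|i J iJ PJ]; first by rewrite cards0.
rewrite cardsU1 above_notin // -wedge_basis_above // -extv_vbasis.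
apply: Pu => //; exact: ext_basis_deg.
Qed.

Lemma ext1_deg : ext1 U \in extp U 0.
Proof. by rewrite -(cards0 'I_d) ext_basis_deg. Qed.

Lemma wedge_deg p q x y :
  x \in extp U p -> y \in extp U q -> wedge x y \in extp U (p + q).
Proof.
move=> /mem_extp x0 /mem_extp y0; rewrite /wedge.
apply: memv_suml => I _; apply: memv_suml => J dIJ.
have [Ip|/x0->] := eqVneq #|I| p; last by rewrite !mul0r scale0r mem0v.
have [Jq|/y0->] := eqVneq #|J| q; last by rewrite mulr0 mul0r scale0r mem0v.
have <- : #|I :|: J| = (p + q)%N.
  by rewrite cardsU Ip Jq (eqP (_ : I :&: J == set0)) ?cards0 ?subn0 ?setI_eq0.
exact/memvZ/ext_basis_deg.
Qed.

Lemma extv_deg u : extv u \in extp U 1.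
Proof.
apply: memv_suml => i _; apply: memvZ.
by rewrite -(cards1 i) ext_basis_deg.
Qed.

(** An element of degree [q] is a sum of products of [q] vectors, and the vector
    [u] anticommutes with each of them. *)
Lemma wedge_extv_sign q x : x \in extp U q -> forall u y,
  wedge (extv u) (wedge x y) = (-1) ^+ q *: wedge x (wedge (extv u) y).
Proof.
elim/extp_ind: q x / => [q c x x' IH IH'|q||q v x _ IH] u y.
- by rewrite !linearPl linearPr /= IH IH' scalerDr !scalerA mulrC.
- by rewrite !linear0l linear0r scaler0.
- by rewrite !wedge1x scale1r.
by rewrite -!wedgeA wedge_extvCA IH linearZr_LR /= -scaleNr exprS mulN1r.
Qed.

End ExteriorAlgebra.

Section ExteriorMap.
Variables (K : fieldType) (U U' : vectType K).
Local Notation d := (\dim {:U}).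

Fact ext_map_is_linear (f : U -> U') : linear (ext_map f).
Proof.
move=> c x y; rewrite /ext_map scaler_sumr -big_split /=; apply: eq_bigr => I _.
by rewrite !ffunE scalerA -scalerDl.
Qed.
HB.instance Definition _ (f : U -> U') :=
  GRing.isLinear.Build K (ext U) (ext U') *:%R (ext_map f) (ext_map_is_linear f).

Lemma ext_map_basis (f : U -> U') (J : {set 'I_d}) : ext_map f (ext_basis J) =
  \big[@wedge K U'/ext1 U']_(i <- enum J) extv (f (vbasis {:U})`_i).
Proof.
rewrite /ext_map (bigD1 J) //= big1 ?addr0 => [|I /negPf nIJ].
  by rewrite ffunE eqxx scale1r.
by rewrite ffunE nIJ scale0r.
Qed.

Lemma ext_map1 (f : U -> U') : ext_map f (ext1 U) = ext1 U'.
Proof. by rewrite ext_map_basis enum_set0 big_nil. Qed.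

Lemma ext_map_above (f : U -> U') (i : 'I_d) J : above i J ->
  ext_map f (ext_basis (i |: J)) =
    wedge (extv (f (vbasis {:U})`_i)) (ext_map f (ext_basis J)).
Proof. by move=> iJ; rewrite !ext_map_basis enum_above // big_cons. Qed.

(** With [ext_ind] this is all of multiplicativity.  On a basis vector [e_i] and
    [e_J] it is shown by induction on [J]: if [i] exceeds the least index [j] of
    [J], exchange [e_i] and [e_j] on both sides. *)
Lemma ext_map_extv (f : {linear U -> U'}) u x :
  ext_map f (wedge (extv u) x) = wedge (extv (f u)) (ext_map f x).
Proof.
elim/ext_basis_ind: x => [c x x' IH IH'|J].
  by rewrite linearPr !linearP linearPr /= IH IH'.
elim/vbasis_ind: u => [c u u' IH IH'||i].
- by rewrite !linearP !linearPl linearP /= IH IH'.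
- by rewrite !linear0 !linear0l linear0.
rewrite extv_vbasis; elim/set_ind_above: J => [|j J jJ IH].
  rewrite -[ext_basis set0]/(ext1 U) wedgex1 -[[set i]]setU0 ext_map_above //.
  by apply/forall_inP => j; rewrite inE.
have [ij|ji|eij] := ltngtP i j.
- have iJ : above i (j |: J).
    apply/forall_inP => k; rewrite !inE => /orP[/eqP-> //|kJ].
    by apply: ltn_trans ij _; move/forall_inP: jJ; apply.
  by rewrite wedge_basis_above // ext_map_above.
- rewrite -wedge_basis_above // -!extv_vbasis wedge_extvCA linearN !extv_vbasis /=.
  rewrite (wedge_basis_above jJ) ext_map_above // wedge_extvCA -IH wedge_basis.
  have jiJ : above j (i |: J).
    apply/forall_inP => k; rewrite !inE => /orP[/eqP-> //|].
    by move/forall_inP: jJ; apply.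
  case: ifP => _; last by rewrite !(linear0, linear0r).
  rewrite linearZr_LR !linearZ linearZr_LR /= wedge_basis_above //.
  by rewrite ext_map_above // scalerN.
have <- : i = j by apply/val_inj.
have iJ : above i J by have <- : j = i by apply/val_inj.
rewrite ext_map_above // wedge_extvvA -wedge_basis_above // -extv_vbasis.
by rewrite wedge_extvvA linear0.
Qed.

Lemma ext_map_wedge (f : {linear U -> U'}) x y :
  ext_map f (wedge x y) = wedge (ext_map f x) (ext_map f y).
Proof.
elim/ext_ind: x => [c x x' IH IH'||u x IH].
- by rewrite linearPl !linearP linearPl /= IH IH'.
- by rewrite ext_map1 !wedge1x.
by rewrite -wedgeA !ext_map_extv IH wedgeA.
Qed.

Lemma ext_map_deg (f : {linear U -> U'}) q x :
  x \in extp U q -> ext_map f x \in extp U' q.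
Proof.
elim/extp_ind: q x / => [q c x y|q||q u x _ IH].
- by rewrite linearP => xq yq; rewrite memvD ?memvZ.
- by rewrite linear0 mem0v.
- by rewrite ext_map1 ext1_deg.
by rewrite ext_map_extv -add1n wedge_deg ?extv_deg.
Qed.

(** The ideal generated by [x] is annihilated by [x].  This is how the
    differences between nested projections disappear. *)
Lemma eq_ext_map_mod (f g : {linear U -> U'}) x y z :
  (forall u, exists c, f u = g u + c *: x) ->
  wedge (extv x) (wedge (ext_map f y) z) = wedge (extv x) (wedge (ext_map g y) z).
Proof.
move=> fg; elim/ext_ind: y z => [c y y' IH IH'||u y IH] z.
- by rewrite !linearP !linearPl !linearPr /= IH IH'.
- by rewrite !ext_map1.
have [c fu] := fg u; rewrite !ext_map_extv -!wedgeA fu linearD linearZ /=.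
rewrite linearDl linearZl_LR linearDr linearZr_LR /= wedge_extvvA scaler0 addr0.
by rewrite !(wedge_extvCA x) IH.
Qed.

End ExteriorMap.

Lemma ext_map_id (K : fieldType) (U : vectType K) (f : {linear U -> U}) :
  f =1 id -> ext_map f =1 id.
Proof.
move=> fid x; elim/ext_ind: x => [c x y IH IH'||u x IH].
- by rewrite linearP /= IH IH'.
- exact: ext_map1.
by rewrite ext_map_extv IH fid.
Qed.

Lemma ext_map_comp (K : fieldType) (U1 U2 U3 : vectType K) (f : {linear U1 -> U2})
    (g : {linear U2 -> U3}) (h : {linear U1 -> U3}) :
  g \o f =1 h -> forall x, ext_map g (ext_map f x) = ext_map h x.
Proof.
move=> gf x; elim/ext_ind: x => [c x y IH IH'||u x IH].
- by rewrite !linearP /= IH IH'.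
- by rewrite !ext_map1.
by rewrite !ext_map_extv IH -[g (f u)]/((g \o f) u) gf.
Qed.

Section ExteriorComponents.
Variables (K : fieldType) (U : vectType K).
Local Notation d := (\dim {:U}).
Implicit Types (x : ext U) (J : {set 'I_d}).

Definition ext_part q x : ext U := [ffun J : {set 'I_d} => if #|J| == q then x J else 0].

Fact ext_part_is_linear q : linear (ext_part q).
Proof.
move=> c x y; apply/ffunP => J; rewrite !ffunE.
by case: ifP => _ //; rewrite scaler0 addr0.
Qed.
HB.instance Definition _ q := GRing.isLinear.Build K (ext U) (ext U) *:%R
  (ext_part q) (ext_part_is_linear q).

Lemma ext_part_deg q x : ext_part q x \in extp U q.
Proof. by apply/mem_extp => J /negPf Jq; rewrite ffunE Jq. Qed.

Lemma ext_part_homog p q x : x \in extp U p ->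
  ext_part q x = if q == p then x else 0.
Proof.
move=> /mem_extp xp; apply/ffunP => J; have [->|qp] := eqVneq q p; rewrite ffunE.
  by case: eqVneq => // /xp ->.
by rewrite ffunE; case: eqVneq => // Jq; rewrite xp // Jq.
Qed.

Lemma ext_part_gt q x : (d < q)%N -> ext_part q x = 0.
Proof.
move=> dq; apply/ffunP => J; rewrite !ffunE; case: eqP => // Jq.
by move: (max_card (mem J)); rewrite card_ord Jq leqNgt dq.
Qed.

Lemma sum_ext_part N x : (d < N)%N -> \sum_(q < N) ext_part q x = x.
Proof.
move=> dN; apply/ffunP => J; have JN : (#|J| < N)%N.
  by apply: leq_ltn_trans dN; rewrite -[d in (_ <= d)%N]card_ord max_card.
rewrite sum_ffunE (bigD1 (Ordinal JN)) //= big1 ?addr0 => [|q].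
  by rewrite ffunE eqxx.
by rewrite -val_eqE /= ffunE eq_sym => /negPf->.
Qed.

End ExteriorComponents.

(** * Tensor products and direct sums *)

Section TensorTheory.
Variables (K : fieldType) (A B : vectType K).
Implicit Types (a : A) (b : B) (x : tensor A B).

Fact tens_bilinear : bilinear_for
  (GRing.Scale.Law.clone _ _ *:%R _) (GRing.Scale.Law.clone _ _ *:%R _)
  (@tens K A B).
Proof.
by split=> [b|a] c u v /=; apply/matrixP => i j; rewrite !mxE linearP /=;
  rewrite ?mulrDl ?mulrDr !mulrA // [c * _]mulrC.
Qed.
HB.instance Definition _ := bilinear_isBilinear.Build K A B (tensor A B)
  _ _ (@tens K A B) tens_bilinear.

Lemma tlift_tens (C : lmodType K) (f : A -> B -> C) a b :
  (forall b, linear (f^~ b)) -> (forall a, linear (f a)) ->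
  tlift f (tens a b) = f a b.
Proof.
have lin_sum (D : vectType K) (g : D -> C) u : linear g ->
    g u = \sum_i coord (vbasis {:D}) i u *: g (vbasis {:D})`_i.
  move=> g_lin; pose gL : {linear D -> C} :=
    HB.pack g (GRing.isLinear.Build K D C *:%R g g_lin).
  rewrite [in LHS](coord_vbasis (memvf u)) -[g]/(gL : D -> C) linear_sum.
  by apply: eq_bigr => i _; rewrite linearZ.
move=> fl fr; rewrite [RHS](lin_sum _ (f^~ b)) //.
apply: eq_bigr => i _; rewrite (lin_sum _ (f _) b) // scaler_sumr.
by apply: eq_bigr => j _; rewrite mxE scalerA.
Qed.

(** Linearity in the bilinear map itself: the product of the complex is a lift
    whose map is again a lift, depending on the other factor. *)
Lemma tlift_lin (C : lmodType K) (f g h : A -> B -> C) c x :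
  (forall a b, h a b = c *: f a b + g a b) ->
  tlift h x = c *: tlift f x + tlift g x.
Proof.
move=> hE; rewrite /tlift scaler_sumr -big_split; apply: eq_bigr => i _.
rewrite scaler_sumr -big_split; apply: eq_bigr => j _ /=.
by rewrite hE scalerDr !scalerA mulrC.
Qed.

Lemma tens_coord x :
  x = \sum_i \sum_j x i j *: tens (vbasis {:A})`_i (vbasis {:B})`_j.
Proof.
rewrite [LHS]matrix_sum_delta; apply: eq_bigr => i _; apply: eq_bigr => j _.
congr (_ *: _); apply/matrixP => k l; rewrite !mxE !coord_free ?(basis_free (vbasisP _)) //.
by rewrite -natrM mulnb ![k == _]eq_sym ![l == _]eq_sym.
Qed.

Lemma tens_ind (P : tensor A B -> Prop) :
  (forall c x y, P x -> P y -> P (c *: x + y)) ->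
  (forall a b, P (tens a b)) -> forall x, P x.
Proof.
move=> PD Pt x; have P0 : P 0 by have <- : tens 0 0 = 0 :> tensor A B by rewrite linear0l.
have PA y z : P y -> P z -> P (y + z).
  by move=> Py Pz; rewrite -[y]scale1r; apply: PD.
rewrite (tens_coord x); apply: big_ind => // i _; apply: big_ind => // j _.
by rewrite -[_ *: _]addr0; apply: PD.
Qed.

Lemma mem_tensv (X : {vspace A}) (Y : {vspace B}) a b :
  a \in X -> b \in Y -> tens a b \in tensv X Y.
Proof.
move=> aX bY; rewrite (coord_vbasis aX) (coord_vbasis bY) linear_sumlz.
apply: memv_suml => i _; rewrite linear_sumr; apply: memv_suml => j _.
rewrite linearZl_LR linearZr_LR; do 2![apply: memvZ]; apply: memv_span.
by apply/allpairsP; exists ((vbasis X)`_i, (vbasis Y)`_j); rewrite !mem_nth ?size_tuple.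
Qed.

Lemma tensv_ind (X : {vspace A}) (Y : {vspace B}) (P : tensor A B -> Prop) :
  (forall c x y, P x -> P y -> P (c *: x + y)) ->
  (forall a b, a \in X -> b \in Y -> P (tens a b)) ->
  forall x, x \in tensv X Y -> P x.
Proof.
move=> PD Pt x xXY.
have P0 : P 0.
  have <- : tens 0 0 = 0 :> tensor A B by rewrite linear0l.
  by apply: Pt; apply: mem0v.
rewrite (coord_span (X := in_tuple _) xXY) /=.
apply: big_ind => // [y z Py Pz|i _]; first by rewrite -[y]scale1r; apply: PD.
rewrite -[_ *: _]addr0; apply: PD => //.
have /allpairsP[[a b] [/= aX bY ->]] := mem_nth 0 (ltn_ord i).
by apply: Pt; apply: vbasis_mem.
Qed.

End TensorTheory.

Section DirectSumTheory.
Variables (K : fieldType) (I : finType) (T : I -> vectType K).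
Implicit Types (a : dsum T) (i j : I).

Definition dsum_in i (x : T i) : dsum T := dsum_of (dfwith (fun=> 0) x).

Lemma dsum_in_same i x : @dsum_in i x i = x.
Proof. by rewrite ffunE dfwith_in. Qed.

Lemma dsum_in_other i j x : i != j -> @dsum_in i x j = 0.
Proof. by move=> nij; rewrite ffunE dfwith_out. Qed.

Fact dsum_in_is_linear i : linear (@dsum_in i).
Proof.
move=> c x y; apply/ffunP => j; rewrite dsumD dsumZ.
have [<-|nij] := eqVneq i j; first by rewrite !dsum_in_same.
by rewrite !dsum_in_other // scaler0 addr0.
Qed.
HB.instance Definition _ i :=
  GRing.isLinear.Build K (T i) (dsum T) *:%R (@dsum_in i) (@dsum_in_is_linear i).

Lemma dsum0 i : (0 : dsum T) i = 0.
Proof. by rewrite -(scale0r 0) dsumZ scale0r. Qed.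

Lemma dsum_sum (J : Type) (r : seq J) (P : pred J) (F : J -> dsum T) i :
  (\sum_(j <- r | P j) F j) i = \sum_(j <- r | P j) F j i.
Proof.
apply: (big_morph (fun a : dsum T => a i)) => [x y|]; [exact: dsumD|exact: dsum0].
Qed.

Lemma dsum_coord a : a = \sum_i dsum_in (a i).
Proof.
apply/ffunP => j; rewrite dsum_sum (bigD1 j) //= dsum_in_same big1 ?addr0 // => i.
by move/dsum_in_other ->.
Qed.

End DirectSumTheory.

(** * Gradings given by projectors *)

Lemma linear_map0 (K : fieldType) (A B : lmodType K) (f : A -> B) :
  linear f -> f 0 = 0.
Proof. by move=> fl; have := fl (-1) 0 0; rewrite scaler0 addr0 scaleN1r addNr. Qed.

Lemma linear_mapB (K : fieldType) (A B : lmodType K) (f : A -> B) :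
  linear f -> {morph f : x y / x - y}.
Proof. by move=> fl x y; rewrite addrC -scaleN1r fl scaleN1r addrC. Qed.

Section Projectors.
Variables (K : fieldType) (A : lmodType K).
Variable (G : nat -> nat -> nat -> A -> Prop).
Variable (pr : nat -> nat -> nat -> A -> A).

(** Describing a trigrading by its projectors turns directness into a formal
    consequence, and lets the grading pass to homology. *)
Record is_projectors : Prop := {
  prj_linear p q r : linear (pr p q r);
  prj_deg p q r x : G p q r (pr p q r x);
  prj_homog p q r p' q' r' x : G p' q' r' x ->
    pr p q r x = if [&& p == p', q == q' & r == r'] then x else 0;
  prj_sum x : exists N, x = \sum_(p < N) \sum_(q < N) \sum_(r < N) pr p q r x
}.

Hypothesis prP : is_projectors.

Lemma prj0 p q r : pr p q r 0 = 0.
Proof. exact/linear_map0/(prj_linear prP). Qed.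

Lemma prjD p q r : {morph pr p q r : x y / x + y}.
Proof. by move=> x y; rewrite -[x]scale1r (prj_linear prP) !scale1r. Qed.

Lemma homog0 p q r : G p q r 0.
Proof. by rewrite -(prj0 p q r); apply: prj_deg. Qed.

Lemma homogP p q r c x y : G p q r x -> G p q r y -> G p q r (c *: x + y).
Proof.
move=> gx gy; suff <- : pr p q r (c *: x + y) = c *: x + y by apply: prj_deg.
by rewrite (prj_linear prP) (prj_homog prP _ _ _ gx) (prj_homog prP _ _ _ gy) !eqxx.
Qed.

Lemma homog_ind (P : A -> Prop) :
  (forall c x y, P x -> P y -> P (c *: x + y)) ->
  (forall p q r x, G p q r x -> P x) -> forall x, P x.
Proof.
move=> PD Pg x; have [N ->] := prj_sum prP x.
have P0 : P 0 := Pg _ _ _ _ (homog0 0 0 0).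
have PA y z : P y -> P z -> P (y + z) by move=> Py Pz; rewrite -[y]scale1r; apply: PD.
do 3![apply: big_ind => // ? _]; apply: Pg; exact: prj_deg.
Qed.

Lemma projectors_trigrading : is_trigrading G.
Proof.
split=> [p q r|x|N c cG c0 p q r pN qN rN].
- by split; [apply: homog0 | move=> k x y; apply: homogP].
- have [N xE] := prj_sum prP x; exists N, (fun p q r => pr p q r x).
  by split=> // p q r; apply: prj_deg.
have := prj0 p q r; rewrite -c0.
have prS (I : finType) (F : I -> A) : pr p q r (\sum_i F i) = \sum_i pr p q r (F i).
  exact: (big_morph _ (prjD p q r) (prj0 p q r)).
have prE i j k : pr p q r (c i j k) = if [&& p == i, q == j & r == k] then c i j k else 0.
  exact: prj_homog.
rewrite prS (bigD1 (Ordinal pN)) //= [X in _ + X]big1 ?addr0 => [|i ni]; last first.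
  rewrite prS big1 // => j _; rewrite prS big1 // => k _; rewrite prE.
  by move: ni; rewrite -val_eqE /= eq_sym => /negPf->.
rewrite prS (bigD1 (Ordinal qN)) //= [X in _ + X]big1 ?addr0 => [|j nj]; last first.
  rewrite prS big1 // => k _; rewrite prE.
  by move: nj; rewrite -val_eqE /= eq_sym => /negPf->; rewrite andbF.
rewrite prS (bigD1 (Ordinal rN)) //= [X in _ + X]big1 ?addr0 => [|k nk]; last first.
  by rewrite prE; move: nk; rewrite -val_eqE /= eq_sym => /negPf->; rewrite !andbF.
by rewrite prE !eqxx.
Qed.

End Projectors.

(** * The homology algebra *)

Section HomologyAlgebra.
Variables (K : fieldType) (A : vectType K) (d : 'End(A)).
Variables (G : nat -> nat -> nat -> A -> Prop) (pr : nat -> nat -> nat -> A -> A).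
Variables (mul : A -> A -> A) (one : A).
Hypothesis prP : is_projectors G pr.
Hypothesis dgaP : is_tridga G mul one d.
Implicit Types (x y : A) (z : cycle_space d).

Let algP := tdga_algebra dgaP.

Definition Hdeg p q r (x : homology d) : Prop :=
  exists2 z : cycle_space d, G p q r (vsval z) & x = hclass z.

Lemma prj_d p q r x : pr p q.+1 r (d x) = d (pr p q r x).
Proof.
elim/(homog_ind prP): x => [c x y IH IH'|p' q' r' x gx].
  by rewrite !(linearP d) !(prj_linear prP) IH IH' linearP.
rewrite (prj_homog prP _ _ _ (tdga_deg dgaP gx)) (prj_homog prP _ _ _ gx) eqSS.
by case: ifP; rewrite ?linear0.
Qed.

Lemma prj_d0 p r x : pr p 0 r (d x) = 0.
Proof.
elim/(homog_ind prP): x => [c x y IH IH'|p' q' r' x gx].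
  by rewrite linearP (prj_linear prP) IH IH' scaler0 addr0.
by rewrite (prj_homog prP _ _ _ (tdga_deg dgaP gx)) /= andbF.
Qed.

Lemma prj_cycle p q r x : d x = 0 -> d (pr p q r x) = 0.
Proof. by move=> dx; rewrite -prj_d dx (prj0 prP). Qed.

(** Since components of cycles are cycles, an induction over cycles may assume
    homogeneity, as the Leibniz rule requires. *)
Lemma cycle_ind (P : A -> Prop) :
  (forall c x y, P x -> P y -> P (c *: x + y)) ->
  (forall p q r x, G p q r x -> d x = 0 -> P x) -> forall x, d x = 0 -> P x.
Proof.
move=> PD Pg x dx; have [N ->] := prj_sum prP x.
have P0 : P 0 by apply: (Pg _ _ _ _ (homog0 prP 0 0 0)); rewrite linear0.
have PA y y' : P y -> P y' -> P (y + y').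
  by move=> Py Py'; rewrite -[y]scale1r; apply: PD.
do 3![apply: big_ind => // ? _].
by apply: Pg; [apply: (prj_deg prP) | apply: prj_cycle].
Qed.

Lemma mul_cycle x y : d x = 0 -> d y = 0 -> d (mul x y) = 0.
Proof.
move=> dx dy; elim/cycle_ind: x / dx => [c x x' IH IH'|p q r x gx dx].
  by rewrite (tga_linearl algP) linearP /= IH IH' scaler0 addr0.
have m0l : mul 0 y = 0 := linear_map0 (tga_linearl algP _).
have m0r : mul x 0 = 0 := linear_map0 (tga_linearr algP _).
by rewrite (tdga_leibniz dgaP _ gx) dx dy m0l m0r scaler0 addr0.
Qed.

Lemma mul_boundary_l u y : d y = 0 -> exists v, mul (d u) y = d v.
Proof.
move=> dy; elim/(homog_ind prP): u => [c u u' [v vE] [v' v'E]|p q r u gu].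
  by exists (c *: v + v'); rewrite !linearP (tga_linearl algP) /= vE v'E.
have m0r : mul u 0 = 0 := linear_map0 (tga_linearr algP _).
by exists (mul u y); rewrite (tdga_leibniz dgaP _ gu) dy m0r scaler0 addr0.
Qed.

Lemma mul_boundary_r x u : d x = 0 -> exists v, mul x (d u) = d v.
Proof.
elim/cycle_ind: x / => [c x x' [v vE] [v' v'E]|p q r x gx dx].
  by exists (c *: v + v'); rewrite linearP (tga_linearl algP) /= vE v'E.
exists ((-1) ^+ q *: mul x u).
have m0l : mul 0 u = 0 := linear_map0 (tga_linearl algP _).
by rewrite linearZ /= (tdga_leibniz dgaP _ gx) dx m0l add0r scalerA -expr2 sqrr_sign scale1r.
Qed.

Lemma d_cycle z : d (vsval z) = 0.
Proof. by apply/eqP; rewrite -memv_ker subvsP. Qed.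

Definition cycle_of x : cycle_space d := vsproj (lker d) x.

Lemma val_cycle_of x : d x = 0 -> vsval (cycle_of x) = x.
Proof. by move=> dx; apply: vsprojK; rewrite memv_ker dx. Qed.

Lemma cycle_of_val z : cycle_of (vsval z) = z.
Proof. exact: vsvalK. Qed.

Lemma hclassP z z' : (exists u, vsval z - vsval z' = d u) <-> hclass z = hclass z'.
Proof.
split=> [[u zz']|/eqP].
  by apply/eqP; rewrite hclass_eq boundaryE linearB /= zz' memv_img ?memvf.
by rewrite hclass_eq boundaryE linearB => /memv_imgP[u _ ->]; exists u.
Qed.

Definition Hprj p q r (x : homology d) : homology d :=
  hclass (cycle_of (pr p q r (vsval (repr x)))).

(** The representatives chosen in the definition do not matter, because the
    projectors send boundaries to boundaries. *)
Lemma Hprj_hclass p q r z :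
  Hprj p q r (hclass z) = hclass (cycle_of (pr p q r (vsval z))).
Proof.
have /hclassP[u zu] := hclassK (hclass z).
apply/hclassP; rewrite !val_cycle_of ?prj_cycle ?d_cycle //.
rewrite -(linear_mapB (prj_linear prP p q r)) zu; case: q => [|q].
  by exists 0; rewrite prj_d0 linear0.
by exists (pr p q r u); rewrite prj_d.
Qed.

Lemma hclass_linear c z z' : hclass (c *: z + z') = c *: hclass z + hclass z' :> homology d.
Proof. by rewrite hclassD hclassZ. Qed.

Lemma hclass0 : hclass 0 = 0 :> homology d.
Proof. by rewrite -(addNr 0) -scaleN1r hclass_linear scaleN1r addNr. Qed.

Lemma hclass_ind (P : homology d -> Prop) : (forall z, P (hclass z)) -> forall a, P a.
Proof. by move=> Pz a; rewrite -(hclassK a). Qed.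

Lemma Hprojectors : is_projectors Hdeg Hprj.
Proof.
split=> [p q r c x y|p q r x|p q r p' q' r' _ [z gz ->]|].
- elim/hclass_ind: x => x; elim/hclass_ind: y => y.
  rewrite -hclass_linear !Hprj_hclass -hclass_linear; congr hclass.
  by rewrite /cycle_of linearP (prj_linear prP) linearP.
- exists (cycle_of (pr p q r (vsval (repr x)))) => //.
  by rewrite val_cycle_of ?prj_cycle ?d_cycle //; apply: (prj_deg prP).
- rewrite Hprj_hclass (prj_homog prP _ _ _ gz); case: ifP => _.
    by rewrite cycle_of_val.
  by rewrite /cycle_of linear0 hclass0.
elim/hclass_ind => z; have [N zE] := prj_sum prP (vsval z); exists N.
have sumH (I : finType) (F : I -> cycle_space d) :
    \sum_i hclass (F i) = hclass (\sum_i F i) :> homology d.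
  by rewrite (big_morph _ (@hclassD _ _ d) hclass0).
rewrite -[in LHS](cycle_of_val z) zE /cycle_of linear_sum -sumH.
apply: eq_bigr => i _; rewrite linear_sum -sumH; apply: eq_bigr => j _.
by rewrite linear_sum -sumH; apply: eq_bigr => k _; rewrite Hprj_hclass.
Qed.

Definition Hmul (x y : homology d) : homology d :=
  hclass (cycle_of (mul (vsval (repr x)) (vsval (repr y)))).

(** Products of cycles with boundaries are boundaries, on either side. *)
Lemma Hmul_hclass z z' :
  Hmul (hclass z) (hclass z') = hclass (cycle_of (mul (vsval z) (vsval z'))).
Proof.
have /hclassP[u zu] := hclassK (hclass z).
have /hclassP[u' zu'] := hclassK (hclass z').
set t := repr _ in zu *; set t' := repr _ in zu' *.
apply/hclassP; rewrite !val_cycle_of ?mul_cycle ?d_cycle //.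
have [v vE] := mul_boundary_l u (d_cycle t').
have [v' v'E] := mul_boundary_r u' (d_cycle z).
exists (v + v'); rewrite linearD /= -vE -v'E -zu -zu'.
rewrite (linear_mapB (tga_linearl algP _)) (linear_mapB (tga_linearr algP _)).
by rewrite addrA subrK.
Qed.

(** The Leibniz rule for [one] times [one] reads [d one = d one + d one]. *)
Lemma d_one : d one = 0.
Proof.
have := tdga_leibniz dgaP one (tga_deg_one algP).
rewrite !(tga_unitl algP) (tga_unitr algP) expr0 scale1r => /eqP.
by rewrite -subr_eq subrr eq_sym => /eqP.
Qed.

Lemma homology_trigraded_algebra :
  is_trigraded_algebra Hdeg Hmul (hclass (cycle_of one)).
Proof.
split.
- exact: projectors_trigrading Hprojectors.
- elim/hclass_ind => y c; elim/hclass_ind => x; elim/hclass_ind => x'.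
  rewrite -hclass_linear !Hmul_hclass -hclass_linear; congr hclass.
  by rewrite /cycle_of -linearP -(tga_linearl algP).
- elim/hclass_ind => x c; elim/hclass_ind => y; elim/hclass_ind => y'.
  rewrite -hclass_linear !Hmul_hclass -hclass_linear; congr hclass.
  by rewrite /cycle_of -linearP -(tga_linearr algP).
- elim/hclass_ind => x; elim/hclass_ind => y; elim/hclass_ind => z.
  by rewrite !Hmul_hclass !val_cycle_of ?mul_cycle ?d_cycle // (tga_assoc algP).
- elim/hclass_ind => x.
  by rewrite Hmul_hclass val_cycle_of ?d_one // (tga_unitl algP) cycle_of_val.
- elim/hclass_ind => x.
  by rewrite Hmul_hclass val_cycle_of ?d_one // (tga_unitr algP) cycle_of_val.
- by exists (cycle_of one); rewrite ?val_cycle_of ?d_one //; apply: (tga_deg_one algP).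
move=> p q r p' q' r' _ _ [x gx ->] [y gy ->]; rewrite Hmul_hclass.
exists (cycle_of (mul (vsval x) (vsval y))) => //.
by rewrite val_cycle_of ?mul_cycle ?d_cycle //; apply: (tga_deg_mul algP).
Qed.

End HomologyAlgebra.

(** * Orthogonal projections *)

Section OrthogonalProjection.
Variables (K : fieldType) (V : vectType K) (f : {symmetric V}).
Implicit Types (U : {vspace V}) (u v x : V).

Lemma form_sym u v : f u v = f v u.
Proof. by rewrite hermC expr0 mul1r. Qed.

(** Each vector of a basis of [U] imposes one linear condition. *)
Lemma dim_orthov U : (\dim {:V} - \dim U <= \dim (orthov f U))%N.
Proof.
have span_dim (s : seq V) : (\dim {:V} <= \dim (orthov f <<s>>) + size s)%N.
  elim: s => [|u s IH]; first by rewrite span_nil orthov0 addn0.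
  have -> : orthov f <<u :: s>> = (orthov f <<s>> :&: orthov f <[u]>)%VS.
    apply/vspaceP => x; rewrite memv_cap span_cons ![x \in orthov _ _]memvE.
    by rewrite orthovD andbC.
  rewrite addnS -addSn; apply: leq_trans IH _; rewrite leq_add2r.
  have := leq_dim_orthov1 f u (orthov f <<s>>).
  by case: (\dim _) => // k; rewrite ltnS.
rewrite leq_subLR addnC; move: (span_dim (vbasis U)).
by rewrite (span_basis (vbasisP U)) size_tuple.
Qed.

Lemma orthov_compl U : nondegenerate_on f U -> (U + orthov f U)%VS = fullv.
Proof.
move=> U_nd; apply/eqP; rewrite eqEdim subvf /= dimv_disjoint_sum //.
by rewrite -leq_subLR dim_orthov.
Qed.

Lemma oproj_mem U x : oproj f U x \in U.
Proof. exact: memv_pi. Qed.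

Lemma oproj_id U u : nondegenerate_on f U -> u \in U -> oproj f U u = u.
Proof. exact: daddv_pi_id. Qed.

Lemma oproj_orth U x u : nondegenerate_on f U -> u \in U ->
  f (oproj f U x) u = f x u.
Proof.
move=> U_nd uU; have := daddv_pi_add U_nd (_ : x \in _).
rewrite orthov_compl // memvf => /(_ isT) {2}<-.
rewrite linearDl /=; have /mem_orthovP-> // := memv_pi (orthov f U) U x.
by rewrite addr0.
Qed.

(** A vector of [U] is determined by its pairings with [U]; in the
    form [oproj_eq] this is how projections are computed. *)
Lemma nondegenerate_eq U u v : nondegenerate_on f U -> u \in U -> v \in U ->
  (forall w, w \in U -> f u w = f v w) -> u = v.
Proof.
move=> U_nd uU vU uv; apply/eqP; rewrite -subr_eq0 -memv0 -U_nd memv_cap memvB //=.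
by apply/mem_orthovP => w wU; rewrite linearBl /= uv // subrr.
Qed.

Lemma oproj_eq U x u : nondegenerate_on f U -> u \in U ->
  (forall w, w \in U -> f u w = f x w) -> oproj f U x = u.
Proof.
move=> U_nd uU ux; apply: (nondegenerate_eq U_nd) => //; first exact: oproj_mem.
by move=> w wU; rewrite oproj_orth // ux.
Qed.

Lemma oproj_comp U U' x : nondegenerate_on f U -> nondegenerate_on f U' ->
  (U' <= U)%VS -> oproj f U' (oproj f U x) = oproj f U' x.
Proof.
move=> U_nd U'_nd /subvP sU; apply: oproj_eq => //; first exact: oproj_mem.
by move=> w wU'; rewrite !oproj_orth // sU.
Qed.

(** Let [p] be the projection of [v] to [U].  If [p] is zero then [U'] is [U].
    Otherwise [p] is not isotropic, as it would be a vector of [U'] orthogonal to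
    [U'], and [U] is the orthogonal sum of [U'] and the line of [p]. *)
Lemma oproj_hyperplane U U' v x :
    nondegenerate_on f U -> nondegenerate_on f U' ->
    (forall u, (u \in U') = (u \in U) && (f u v == 0)) ->
  exists c, oproj f U' x = oproj f U x + c *: oproj f U v.
Proof.
move=> U_nd U'_nd U'E; set p := oproj f U v; have pU : p \in U by apply: oproj_mem.
have fp u : u \in U -> f u p = f u v.
  by move=> uU; rewrite form_sym oproj_orth // form_sym.
have [fpp0|fpp] := eqVneq (f p p) 0.
  (* An isotropic [p] lies in [U'] and is orthogonal to it. *)
  have pU' : p \in U' by rewrite U'E pU -fp // fpp0 eqxx.
  have p0 : p = 0.
    apply: (nondegenerate_eq U'_nd) => //; first exact: mem0v.
    move=> w; rewrite U'E => /andP[wU /eqP fw].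
    by rewrite linear0l form_sym fp.
  exists 0; rewrite scale0r addr0; apply: oproj_eq => //.
    by rewrite U'E oproj_mem -fp ?oproj_mem // p0 linear0r eqxx.
  by move=> w; rewrite U'E => /andP[wU _]; rewrite oproj_orth.
exists (- (f (oproj f U x) p / f p p)); apply: oproj_eq => //.
  rewrite U'E memvD ?memvZ ?oproj_mem //= -fp ?memvD ?memvZ ?oproj_mem //.
  by rewrite linearDl linearZl_LR /= mulNr divfK // subrr.
move=> w; rewrite U'E => /andP[wU /eqP fw].
rewrite linearDl linearZl_LR /= oproj_orth // [f p w]form_sym fp // fw.
by rewrite mulr0 addr0.
Qed.

End OrthogonalProjection.

(** * The complex on simple tensors *)

Section Complex.
Variables (K : fieldType) (V : vectType K) (form : {symmetric V}).
Variables (n : nat) (nu : 'I_n -> V).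
Implicit Types (S T R : {set 'I_n}) (s t u : 'I_n).

Local Notation H := (Hsp form nu).
Local Notation W := (Wsp nu).
Local Notation CT := (CT form nu).
Local Notation CTdeg := (@CTdeg K V form n nu).
Local Notation mCT := (@mCT K V form n nu).
Local Notation dCT := (dCT form nu).
Local Notation Hincl := (@Hincl K V form n nu).
Local Notation Hproj := (@Hproj K V form n nu).
Local Notation Wincl := (@Wincl K V n nu).
Local Notation Wproj := (@Wproj K V n nu).

Fact Hincl_is_linear S R : linear (@Hincl S R).
Proof. by move=> c x y; rewrite /Defs.Hincl !linearP. Qed.
HB.instance Definition _ S R := GRing.isLinear.Build K (HS form nu S) (HS form nu R)
  *:%R (@Hincl S R) (@Hincl_is_linear S R).

Fact Hproj_is_linear S R : linear (@Hproj S R).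
Proof. by move=> c x y; rewrite /Defs.Hproj /oproj !linearP. Qed.
HB.instance Definition _ S R := GRing.isLinear.Build K (HS form nu S) (HS form nu R)
  *:%R (@Hproj S R) (@Hproj_is_linear S R).

Fact Wincl_is_linear S R : linear (@Wincl S R).
Proof. by move=> c x y; rewrite /Defs.Wincl !linearP. Qed.
HB.instance Definition _ S R := GRing.isLinear.Build K (WS nu S) (WS nu R)
  *:%R (@Wincl S R) (@Wincl_is_linear S R).

Fact Wproj_is_linear S R : linear (@Wproj S R).
Proof. by move=> c x y; rewrite /Defs.Wproj /oproj !linearP. Qed.
HB.instance Definition _ S R := GRing.isLinear.Build K (WS nu S) (WS nu R)
  *:%R (@Wproj S R) (@Wproj_is_linear S R).

(** The simple tensor [h (x) w], placed in the summand of index [S].  Below, the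
    summand in which a product lies is a free variable [R] with an equation
    [S :|: T = R]; equal index sets can thus be exchanged without transporting
    elements between summands. *)
Definition simple S (h : ext (HS form nu S)) (w : ext (WS nu S)) : CT :=
  dsum_in (tens h w).

Lemma simple_same S h w : @simple S h w S = tens h w.
Proof. exact: dsum_in_same. Qed.

Lemma simple_other S R h w : S != R -> @simple S h w R = 0.
Proof. exact: dsum_in_other. Qed.

Lemma simplePl S c h h' w : @simple S (c *: h + h') w = c *: simple h w + simple h' w.
Proof. by rewrite /simple linearPl linearP. Qed.

Lemma simple0l S w : @simple S 0 w = 0.
Proof. by rewrite /simple linear0l linear0. Qed.

Lemma simple0r S h : @simple S h 0 = 0.
Proof. by rewrite /simple linear0r linear0. Qed.

Lemma simpleZl S c h w : @simple S (c *: h) w = c *: simple h w.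
Proof. by rewrite -[c *: h]addr0 simplePl simple0l addr0. Qed.

Lemma simpleNl S h w : @simple S (- h) w = - simple h w.
Proof. by rewrite -!scaleN1r simpleZl. Qed.

Lemma CT_ind (P : CT -> Prop) :
  (forall c a b, P a -> P b -> P (c *: a + b)) ->
  (forall S h w, P (@simple S h w)) -> forall a, P a.
Proof.
move=> PD Pg a; have P0 : P 0 by rewrite -(@simple0l set0 0).
rewrite (dsum_coord a); apply: big_ind => // [x y Px Py|S _].
  by rewrite -[x]scale1r; apply: PD.
elim/tens_ind: (a S) => [c x y Px Py|h w]; last exact: Pg.
by rewrite linearP; apply: PD.
Qed.

Lemma CTdeg0 p q r : CTdeg p q r 0.
Proof. by move=> S; rewrite dsum0 mem0v. Qed.

Lemma CTdegP p q r c a b :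
  CTdeg p q r a -> CTdeg p q r b -> CTdeg p q r (c *: a + b).
Proof.
move=> da db S; rewrite dsumD dsumZ; apply: rpredD; last exact: db.
exact/rpredZ/da.
Qed.

Lemma CTdeg_sum p q r (I : finType) (P : pred I) (F : I -> CT) :
  (forall i, P i -> CTdeg p q r (F i)) -> CTdeg p q r (\sum_(i | P i) F i).
Proof.
move=> dF; apply: big_ind => // [|a b da db]; first exact: CTdeg0.
by rewrite -[a]scale1r; apply: CTdegP.
Qed.

Lemma CTdeg_simple p q r S h w : (#|S| + q)%N = p ->
  h \in extp _ q -> w \in extp _ r -> CTdeg p q r (@simple S h w).
Proof.
move=> <- hq wr R; have [<-|nSR] := eqVneq S R; last by rewrite simple_other ?mem0v.
by rewrite simple_same eqxx mem_tensv.
Qed.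

Lemma CTdeg_ind p q r (P : CT -> Prop) :
  (forall c a b, P a -> P b -> P (c *: a + b)) ->
  (forall S h w, (#|S| + q)%N = p -> h \in extp _ q -> w \in extp _ r ->
     P (@simple S h w)) ->
  P 0 -> forall a, CTdeg p q r a -> P a.
Proof.
move=> PD Pg P0 a da.
rewrite (dsum_coord a); apply: big_ind => // [x y Px Py|S _].
  by rewrite -[x]scale1r; apply: PD.
move: (da S); case: eqP => [Spq|_]; last first.
  by rewrite memv0 => /eqP->; rewrite linear0.
move: (a S); apply: tensv_ind => [c x y Px Py|h w hq wr]; last exact: Pg.
by rewrite linearP; apply: PD.
Qed.

Fact bmap_is_linear S R : linear (@bmap K V n nu S R).
Proof. exact: ext_map_is_linear. Qed.
HB.instance Definition _ S R := GRing.isLinear.Build K (ext (WS nu S)) (ext (WS nu R))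
  *:%R (@bmap K V n nu S R) (@bmap_is_linear S R).

Fact wmap_is_linear S s R : linear (@wmap K V form n nu S s R).
Proof. by move=> c x y; rewrite /wmap linearP linearPr. Qed.
HB.instance Definition _ S s R := GRing.isLinear.Build K (ext (HS form nu S))
  (ext (HS form nu R)) *:%R (@wmap K V form n nu S s R) (@wmap_is_linear S s R).

Lemma dCS_tens S s R h w :
  @dCS K V form n nu S s R (tens h w) = tens (wmap s R h) (bmap R w).
Proof.
by apply: tlift_tens => [w' c x y|h' c x y]; rewrite linearP ?linearPl ?linearPr.
Qed.

Lemma dCT_simple S h w : dCT (@simple S h w) =
  \sum_(s in S) simple (wmap s (S :\ s) h) (bmap (S :\ s) w).
Proof.
rewrite lfunE; apply/ffunP => R; rewrite dCT_funE dsum_sum.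
rewrite (bigD1 S) //= [X in _ + X]big1 ?addr0 => [|T nTS]; last first.
  by apply: big1 => s _; rewrite simple_other 1?eq_sym // /dCS linear0.
rewrite big_mkcondr; apply: eq_bigr => s _.
have [<-|nSR] := eqVneq (S :\ s) R; last by rewrite simple_other.
by rewrite !simple_same dCS_tens.
Qed.

Fact mCS_bilinear S T R : bilinear_for
  (GRing.Scale.Law.clone _ _ *:%R _) (GRing.Scale.Law.clone _ _ *:%R _)
  (@mCS K V form n nu S T R).
Proof.
split=> [y|x] c a b /=; first exact: linearP.
by apply: tlift_lin => h w; rewrite linearP.
Qed.
HB.instance Definition _ S T R := bilinear_isBilinear.Build K
  (CS form nu S) (CS form nu T) (CS form nu R) _ _ (@mCS K V form n nu S T R)
  (@mCS_bilinear S T R).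

Lemma mCTE a b R : mCT a b R =
  \sum_(S : {set 'I_n}) \sum_(T : {set 'I_n} | [disjoint S & T] && (S :|: T == R))
    mCS R (a S) (b T).
Proof. exact: ffunE. Qed.

Fact mCT_bilinear : bilinear_for
  (GRing.Scale.Law.clone _ _ *:%R _) (GRing.Scale.Law.clone _ _ *:%R _) mCT.
Proof.
split=> [y|x] c a b /=; apply/ffunP => R; rewrite dsumD dsumZ !mCTE;
  rewrite scaler_sumr -big_split; apply: eq_bigr => S _;
  rewrite scaler_sumr -big_split; apply: eq_bigr => T _; rewrite dsumD dsumZ.
  exact: linearPl.
exact: linearPr.
Qed.
HB.instance Definition _ := bilinear_isBilinear.Build K CT CT CT _ _ mCT mCT_bilinear.

Lemma mCS_tens S T R h1 w1 h2 w2 :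
  @mCS K V form n nu S T R (tens h1 w1) (tens h2 w2) =
  tens (wedge (ext_map (@Hproj S R) h1) (ext_map (@Hproj T R) h2))
       (wedge (ext_map (@Wincl S R) w1) (ext_map (@Wincl T R) w2)).
Proof.
rewrite /mCS tlift_tens.
- by apply: tlift_tens => [w' c x y|h' c x y]; rewrite linearP linearPr ?linearPl ?linearPr.
- by move=> w' c x y; apply: tlift_lin => h w; rewrite linearP !linearPl.
by move=> h' c x y; apply: tlift_lin => h w; rewrite linearP linearPl linearPr.
Qed.

Lemma mCT_simple_nondisj S T h1 w1 h2 w2 : ~~ [disjoint S & T] ->
  mCT (@simple S h1 w1) (@simple T h2 w2) = 0.
Proof.
move=> nST; apply/ffunP => R; rewrite mCTE dsum0.
apply: big1 => S' _; apply: big1 => T' /andP[dST _].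
have [eS|nS] := eqVneq S S'; last by rewrite simple_other // linear0l.
have [eT|nT] := eqVneq T T'; last by rewrite [simple h2 w2 _]simple_other // linear0r.
by rewrite eS eT dST in nST.
Qed.

Lemma mCT_simple S T R h1 w1 h2 w2 : [disjoint S & T] -> S :|: T = R ->
  mCT (@simple S h1 w1) (@simple T h2 w2) =
  simple (wedge (ext_map (@Hproj S R) h1) (ext_map (@Hproj T R) h2))
      (wedge (ext_map (@Wincl S R) w1) (ext_map (@Wincl T R) w2)).
Proof.
move=> dST <-; apply/ffunP => R'; rewrite mCTE (bigD1 S) //=.
rewrite [X in _ + X]big1 ?addr0 => [|S' nS']; last first.
  by apply: big1 => T' _; rewrite simple_other 1?eq_sym // linear0l.
have [<-|nR] := eqVneq (S :|: T) R'; last first.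
  rewrite [RHS]simple_other // big1 // => T' /andP[_ eR'].
  have [eT|nT] := eqVneq T T'; last by rewrite [simple h2 w2 _]simple_other // linear0r.
  by rewrite eT eR' in nR.
rewrite (bigD1 T) /= ?dST ?eqxx // big1 ?addr0 => [|T' /andP[_ nT]].
  by rewrite !simple_same mCS_tens.
by rewrite [simple h2 w2 _]simple_other 1?eq_sym // linear0r.
Qed.

Lemma one_simple : oneCT form nu = @simple set0 (ext1 _) (ext1 _).
Proof.
apply/ffunP => S; rewrite [LHS]ffunE; have [->|nS] := eqVneq S set0.
  by rewrite simple_same.
by rewrite simple_other // eq_sym.
Qed.

(** * The square of the differential *)

Hypothesis H_nd : forall S, nondegenerate_on form (H S).
Hypothesis W_nd : forall S s, s \in S ->
  nondegenerate_on (@stdform K n) (W (S :\ s)).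

Lemma Hsp_sub S R : S \subset R -> (H R <= H S)%VS.
Proof.
by move=> /subsetP sSR; apply/subvP => x /mem_Hsp xR; apply/mem_Hsp => s /sSR; apply: xR.
Qed.

Lemma Wsp_sub S R : S \subset R -> (W S <= W R)%VS.
Proof.
move=> /subsetP sSR; apply/subvP => w /mem_Wsp[w0 wS]; apply/mem_Wsp.
by split=> // r rR; apply: wS; apply: contra rR; apply: sSR.
Qed.

Lemma Hsp_D1 R u x : u \in R ->
  (x \in H R) = (x \in H (R :\ u)) && (form x (nu u) == 0).
Proof.
move=> uR; apply/mem_Hsp/andP => [xR|[/mem_Hsp xR' /eqP xu] s sR].
  by split; [apply/mem_Hsp => s /setD1P[_]; apply: xR | rewrite xR].
by have [->//|su] := eqVneq s u; rewrite xR' // !inE su.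
Qed.

Lemma val_Hincl S R (h : HS form nu S) : R \subset S -> vsval (Hincl R h) = vsval h.
Proof. by move=> sRS; apply/vsprojK/(subvP (Hsp_sub sRS))/subvsP. Qed.

Lemma val_Hproj S R (h : HS form nu S) :
  vsval (Hproj R h) = oproj form (H R) (vsval h).
Proof. exact/vsprojK/oproj_mem. Qed.

Lemma val_Wincl S R (w : WS nu S) : S \subset R -> vsval (Wincl R w) = vsval w.
Proof. by move=> sSR; apply/vsprojK/(subvP (Wsp_sub sSR))/subvsP. Qed.

Lemma val_Wproj S R (w : WS nu S) :
  vsval (Wproj R w) = oproj (@stdform K n) (W R) (vsval w).
Proof. exact/vsprojK/oproj_mem. Qed.

(** [p_R (nu_u)], the vector by which the differential wedges. *)
Definition nuH R u : HS form nu R := vsproj (H R) (oproj form (H R) (nu u)).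

Lemma val_nuH R u : vsval (nuH R u) = oproj form (H R) (nu u).
Proof. exact/vsprojK/oproj_mem. Qed.

(** [nu_u] is orthogonal to [H R] for [u] in [R]. *)
Lemma nuH0 R u : u \in R -> nuH R u = 0.
Proof.
move=> uR; apply/val_inj; rewrite /= val_nuH; apply: oproj_eq => //; first exact: mem0v.
by move=> w /mem_Hsp wR; rewrite linear0l form_sym wR.
Qed.

Lemma Hproj_nuH R R' u : R \subset R' -> Hproj R' (nuH R u) = nuH R' u.
Proof.
move=> sR; apply/val_inj; rewrite /= val_Hproj !val_nuH.
by apply: oproj_comp => //; apply: Hsp_sub.
Qed.

Lemma Hincl_nuH R t u : t \in R ->
  exists c, Hincl (R :\ t) (nuH R u) = nuH (R :\ t) u + c *: nuH (R :\ t) t.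
Proof.
move=> tR; have [c eqc] := oproj_hyperplane (nu u) (H_nd (R :\ t)) (H_nd R)
  (fun x => Hsp_D1 x tR).
exists c; apply/val_inj; rewrite /= val_Hincl ?subsetDl //.
by rewrite !val_nuH.
Qed.

(** By [Hincl_nuH] the projection of [nu s] at the intermediate stage [S :\ s]
    may be replaced by the one at the final stage, next to the vector of [t]. *)
Lemma wmap_wmap S s t h : t \in S :\ s ->
  wmap t (S :\ s :\ t) (wmap s (S :\ s) h) =
  wedge (extv (nuH (S :\ s :\ t) t)) (wedge (extv (nuH (S :\ s :\ t) s))
    (ext_map (@Hincl S (S :\ s :\ t)) h)).
Proof.
move=> tS; rewrite /wmap -!/(nuH _ _) ext_map_extv.
have [c cE] := Hincl_nuH s tS; rewrite /= -/(nuH _ _) cE.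
rewrite linearD linearZ linearDl linearZl_LR /= linearDr linearZr_LR /=.
rewrite wedge_extvvA scaler0 addr0.
rewrite (@ext_map_comp _ _ _ _ _ _ (@Hincl S (S :\ s :\ t))) // => x.
apply/val_inj; rewrite /= !val_Hincl ?subsetDl //.
by rewrite (subset_trans (subsetDl _ _)) ?subsetDl.
Qed.

Lemma bmap_bmap S s t w : s \in S -> t \in S :\ s ->
  bmap (S :\ s :\ t) (bmap (S :\ s) w) = @bmap K V n nu S (S :\ s :\ t) w.
Proof.
move=> sS tS; apply: ext_map_comp => x; apply/val_inj; rewrite /= !val_Wproj.
by apply: oproj_comp; [exact: W_nd|exact: W_nd|apply: Wsp_sub; apply: subsetDl].
Qed.

(** The double sum is antisymmetric in [s] and [t], hence equal to its
    opposite. *)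
Lemma dCT_sq a : [pchar K] =i pred0 -> dCT (dCT a) = 0.
Proof.
move=> char0; elim/CT_ind: a => [c a b IHa IHb|S h w].
  by rewrite !linearP /= IHa IHb scaler0 addr0.
rewrite dCT_simple linear_sum /=.
under eq_bigr => s sS do rewrite dCT_simple.
set F := fun s t => simple (wedge (extv (nuH (S :\ s :\ t) t))
  (wedge (extv (nuH (S :\ s :\ t) s)) (ext_map (@Hincl S (S :\ s :\ t)) h)))
  (@bmap K V n nu S (S :\ s :\ t) w).
rewrite (eq_bigr (fun s => \sum_(t in S :\ s) F s t)); last first.
  by move=> s sS; apply: eq_bigr => t tS; rewrite wmap_wmap // bmap_bmap.
set X := \sum_(s in S) _.
have XN : X = - X.
  rewrite {1}/X (exchange_big_dep (mem S)) /=; last by move=> s t _ /setD1P[].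
  rewrite -sumrN; apply: eq_bigr => t tS; rewrite -sumrN; apply: eq_big => [s|s _].
    by rewrite !inE tS andbT eq_sym andbC.
  have eqS : S :\ s :\ t = S :\ t :\ s by rewrite !setDDl setUC.
  by rewrite /F eqS wedge_extvCA simpleNl.
have /eqP := subrr X; rewrite {2}XN opprK -mulr2n -scaler_nat scaler_eq0.
by rewrite ((pcharf0P K).1 char0) => /eqP.
Qed.

(** * The algebra structure *)

Lemma ext_map_Hproj S R R' h : R \subset R' ->
  ext_map (@Hproj R R') (ext_map (@Hproj S R) h) = ext_map (@Hproj S R') h.
Proof.
move=> sR; apply: ext_map_comp => x; apply/val_inj; rewrite /= !val_Hproj.
by apply: oproj_comp => //; apply: Hsp_sub.
Qed.

Lemma ext_map_Wincl S R R' w : S \subset R -> R \subset R' ->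
  ext_map (@Wincl R R') (ext_map (@Wincl S R) w) = ext_map (@Wincl S R') w.
Proof.
move=> sSR sR; apply: ext_map_comp => x; apply/val_inj.
by rewrite /= !val_Wincl // (subset_trans sSR).
Qed.

Lemma mCT_assoc : associative mCT.
Proof.
move=> a b c.
elim/CT_ind: a => [k a a' IH IH'|S h w]; first by rewrite !linearPl /= IH IH'.
elim/CT_ind: b => [k b b' IH IH'|T h' w'].
  by rewrite linearPl !linearPr linearPl /= IH IH'.
elim/CT_ind: c => [k c c' IH IH'|Q h'' w'']; first by rewrite !linearPr /= IH IH'.
have [dTQ|nTQ] := boolP [disjoint T & Q]; last first.
  rewrite (mCT_simple_nondisj _ _ _ _ nTQ) linear0r.
  have [dST|nST] := boolP [disjoint S & T].
    rewrite (mCT_simple _ _ _ _ dST erefl) mCT_simple_nondisj //.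
    by rewrite disjoints_Ul (negPf nTQ) andbF.
  by rewrite (mCT_simple_nondisj _ _ _ _ nST) linear0l.
rewrite (mCT_simple _ _ _ _ dTQ erefl).
have [dST|nST] := boolP [disjoint S & T]; last first.
  rewrite (mCT_simple_nondisj _ _ _ _ nST) linear0l.
  by rewrite mCT_simple_nondisj // disjoints_Ur (negPf nST).
rewrite (mCT_simple _ _ _ _ dST erefl).
have [dSQ|nSQ] := boolP [disjoint S & Q]; last first.
  by rewrite !mCT_simple_nondisj // ?disjoints_Ul ?disjoints_Ur (negPf nSQ) // andbF.
rewrite (mCT_simple (R := S :|: (T :|: Q))) ?disjoints_Ur ?dST //.
rewrite (mCT_simple (R := S :|: (T :|: Q))) ?disjoints_Ul ?dSQ ?setUA //.
rewrite -setUA !ext_map_wedge !wedgeA !ext_map_Hproj ?ext_map_Wincl //.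
all: by rewrite ?subsetUl ?subsetUr // setUS ?subsetUl.
Qed.

Lemma ext_map_Hproj_id S h : ext_map (@Hproj S S) h = h.
Proof.
apply: ext_map_id => x; apply/val_inj; rewrite /= val_Hproj.
by apply: oproj_id => //; apply: subvsP.
Qed.

Lemma ext_map_Wincl_id S w : ext_map (@Wincl S S) w = w.
Proof. by apply: ext_map_id => x; apply/val_inj; rewrite /= val_Wincl. Qed.

Lemma mCT_1l : left_id (oneCT form nu) mCT.
Proof.
move=> a; elim/CT_ind: a => [c a b IH IH'|S h w]; first by rewrite linearPr /= IH IH'.
rewrite one_simple (mCT_simple (R := S)) ?set0U //; last by rewrite -setI_eq0 set0I.
by rewrite !ext_map1 !wedge1x ext_map_Hproj_id ext_map_Wincl_id.
Qed.

Lemma mCT_1r : right_id (oneCT form nu) mCT.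
Proof.
move=> a; elim/CT_ind: a => [c a b IH IH'|S h w]; first by rewrite linearPl /= IH IH'.
rewrite one_simple (mCT_simple (R := S)) ?setU0 //; last by rewrite -setI_eq0 setI0.
by rewrite !ext_map1 !wedgex1 ext_map_Hproj_id ext_map_Wincl_id.
Qed.

Lemma oneCT_deg : CTdeg 0 0 0 (oneCT form nu).
Proof. by rewrite one_simple; apply: CTdeg_simple; rewrite ?cards0 ?ext1_deg. Qed.

Lemma mCT_deg p q r p' q' r' a b : CTdeg p q r a -> CTdeg p' q' r' b ->
  CTdeg (p + p') (q + q') (r + r') (mCT a b).
Proof.
move=> da db; elim/CTdeg_ind: a / da => [c a a' da da'|S h w Sp hq wr|].
- by rewrite linearPl; apply: CTdegP.
- elim/CTdeg_ind: b / db => [c b b' db db'|T h' w' Tp hq' wr'|].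
  + by rewrite linearPr; apply: CTdegP.
  + have [dST|nST] := boolP [disjoint S & T]; last first.
      by rewrite mCT_simple_nondisj //; apply: CTdeg0.
    rewrite (mCT_simple _ _ _ _ dST erefl); apply: CTdeg_simple.
    * have /eqP SIT : S :&: T == set0 by rewrite setI_eq0.
      by rewrite cardsU SIT cards0 subn0 addnACA Sp Tp.
    * by rewrite wedge_deg ?ext_map_deg.
    * by rewrite wedge_deg ?ext_map_deg.
  by rewrite linear0r; apply: CTdeg0.
by rewrite linear0l; apply: CTdeg0.
Qed.

Lemma dCT_deg p q r a : CTdeg p q r a -> CTdeg p q.+1 r (dCT a).
Proof.
move=> da; elim/CTdeg_ind: a / da => [c a b da db|S h w Sp hq wr|].
- by rewrite linearP; apply: CTdegP.
- rewrite dCT_simple; apply: CTdeg_sum => s sS; apply: CTdeg_simple.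
  + by rewrite -Sp (cardsD1 s S) sS addnS.
  + by rewrite /wmap -add1n wedge_deg ?extv_deg ?ext_map_deg.
  + by rewrite /bmap ext_map_deg.
by rewrite linear0; apply: CTdeg0.
Qed.

(** * The Leibniz rule *)

(** Pairing a relation [w] with the vectors of [H (R :\ u)] leaves only the
    term of index [u]. *)
Lemma relation_coord0 R u (w : 'rV[K]_n) : nuH (R :\ u) u != 0 -> w \in W R -> w 0 u = 0.
Proof.
move=> nz /mem_Wsp[w0 wR]; apply: contra_neq_eq nz => wu.
apply/val_inj; rewrite /= val_nuH; apply: oproj_eq => //; first exact: mem0v.
move=> y /mem_Hsp yR; have := linear0l form y; rewrite -w0 linear_sumlz.
rewrite (bigD1 u) //= big1 ?addr0 => [|i iu].
  by rewrite linearZl_LR w0 linear0l /= => /eqP; rewrite mulf_eq0 (negPf wu) => /eqP.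
rewrite linearZl_LR /=; have [iR|/wR->] := boolP (i \in R); last by rewrite mul0r.
by rewrite form_sym yR ?mulr0 // !inE iu.
Qed.

Lemma Wsp_D1 R u (w : 'rV[K]_n) : w 0 u = 0 -> w \in W R -> w \in W (R :\ u).
Proof.
move=> wu /mem_Wsp[w0 wR]; apply/mem_Wsp; split=> // r.
by rewrite !inE negb_and negbK => /orP[/eqP->|/wR].
Qed.

(** The two projections of [h] differ by a vector that disappears when wedged
    with the vector of [u]. *)
Lemma Hproj_mod S R u (h : HS form nu S) : u \in R -> exists c,
  Hincl (R :\ u) (Hproj R h) = Hproj (R :\ u) h + c *: nuH (R :\ u) u.
Proof.
move=> uR; have [c eqc] := oproj_hyperplane (vsval h) (H_nd (R :\ u)) (H_nd R)
  (fun x => Hsp_D1 x uR).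
exists c; apply/val_inj; rewrite /= val_Hincl ?subsetDl //.
by rewrite !val_Hproj val_nuH.
Qed.

Lemma wmap_Hproj S T R u q h k : u \in R -> h \in extp _ q ->
  wmap u (R :\ u) (wedge (ext_map (@Hproj S R) h) (ext_map (@Hproj T R) k)) =
  wedge (extv (nuH (R :\ u) u))
    (wedge (ext_map (@Hproj S (R :\ u)) h) (ext_map (@Hproj T (R :\ u)) k)).
Proof.
move=> uR hq; rewrite /wmap -/(nuH _ _) ext_map_wedge.
have compE Q y : ext_map (@Hincl R (R :\ u)) (ext_map (@Hproj Q R) y) =
    ext_map (@Hincl R (R :\ u) \o @Hproj Q R) y by exact: ext_map_comp.
have modE Q y z : wedge (extv (nuH (R :\ u) u))
      (wedge (ext_map (@Hincl R (R :\ u) \o @Hproj Q R) y) z) =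
    wedge (extv (nuH (R :\ u) u)) (wedge (ext_map (@Hproj Q (R :\ u)) y) z).
  by apply: eq_ext_map_mod => x; apply: Hproj_mod.
(* Bringing the vector of u next to the second factor and back. *)
have modE1 := modE T k (ext1 _); rewrite !wedgex1 in modE1.
by rewrite !compE modE !(wedge_extv_sign (ext_map_deg _ hq)) modE1.
Qed.

(** Where the vector of [u] is nonzero, all relations on [R] vanish at [u], so
    projecting them to the relations on [R :\ u] does nothing. *)
Lemma bmap_Wincl S T R u w v : u \in R -> S \subset R -> T \subset R ->
  nuH (R :\ u) u != 0 ->
  bmap (R :\ u) (wedge (ext_map (@Wincl S R) w) (ext_map (@Wincl T R) v)) =
  wedge (ext_map (@Wincl S (R :\ u)) w) (ext_map (@Wincl T (R :\ u)) v).
Proof.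
move=> uR sSR sTR nz; rewrite /bmap ext_map_wedge.
have WE (Q : {set 'I_n}) y : Q \subset R ->
    ext_map (@Wproj R (R :\ u)) (ext_map (@Wincl Q R) y) =
    ext_map (@Wincl Q (R :\ u)) y.
  move=> sQR; apply: ext_map_comp => x; apply/val_inj.
  have xR : vsval x \in W R by apply/(subvP (Wsp_sub sQR))/subvsP.
  have xR' := Wsp_D1 (relation_coord0 nz xR) xR.
  by rewrite /= val_Wproj val_Wincl // vsprojK // oproj_id //; apply: W_nd.
by rewrite !WE.
Qed.

(** As for [bmap_Wincl], for the projection that comes before the product. *)
Lemma Wincl_bmap S R s w : s \in S -> S :\ s \subset R -> s \notin R ->
  nuH R s != 0 ->
  ext_map (@Wincl (S :\ s) R) (bmap (S :\ s) w) = ext_map (@Wincl S R) w.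
Proof.
move=> sS sSR sR nz; apply: ext_map_comp => x; apply/val_inj.
have nz' : nuH ((s |: R) :\ s) s != 0 by rewrite setU1K.
have xR : vsval x \in W (s |: R).
  by apply: (subvP (Wsp_sub _)) (subvsP x); rewrite -subDset.
have xS := Wsp_D1 (relation_coord0 nz' xR) (subvsP x).
rewrite /= val_Wincl // val_Wproj oproj_id //; last exact: W_nd.
by rewrite /Defs.Wincl vsprojK //; apply: (subvP (Wsp_sub sSR)).
Qed.

Lemma Hproj_wmap S R s h : S :\ s \subset R ->
  ext_map (@Hproj (S :\ s) R) (wmap s (S :\ s) h) =
  wedge (extv (nuH R s)) (ext_map (@Hproj S R) h).
Proof.
move=> sSR; rewrite /wmap -/(nuH _ _) ext_map_extv /= Hproj_nuH //; congr wedge.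
apply: ext_map_comp => x; apply/val_inj; rewrite /= !val_Hproj val_Hincl //.
exact: subsetDl.
Qed.

(** The terms of the two sides correspond index by index; they are compared via
    the common form with all vectors projected directly to [H (R :\ u)]. *)
Lemma dCT_leibniz_simple S T q h w k v : h \in extp _ q ->
  dCT (mCT (simple (S := S) h w) (simple (S := T) k v)) =
  mCT (dCT (simple h w)) (simple k v) + (-1) ^+ q *: mCT (simple h w) (dCT (simple k v)).
Proof.
move=> hq; rewrite !dCT_simple linear_sumlz linear_sumr /=.
have [dST|nST] := boolP [disjoint S & T]; last first.
  rewrite mCT_simple_nondisj // linear0 !big1 ?scaler0 ?addr0 // => s sS.
    (* A nonzero product here means that s is in S as well. *)
    have [dST|nST'] := boolP [disjoint S & T :\ s]; last by rewrite mCT_simple_nondisj.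
    rewrite (mCT_simple _ _ _ _ dST erefl) Hproj_wmap ?subsetUr // nuH0.
      by rewrite linear0 linear0l linear0r simple0l.
    rewrite inE; apply/orP; left; apply: contraR nST => sS'.
    by rewrite -(setD1K sS) disjoints_Ur disjoint_sym disjoints1 sS'.
  have [dST|nST'] := boolP [disjoint S :\ s & T]; last by rewrite mCT_simple_nondisj.
  rewrite (mCT_simple _ _ _ _ dST erefl) Hproj_wmap ?subsetUl // nuH0.
    by rewrite linear0 !linear0l simple0l.
  rewrite inE; apply/orP; right; apply: contraR nST => sS'.
  by rewrite -(setD1K sS) disjoints_Ul disjoints1 sS'.
set R := S :|: T; rewrite (mCT_simple _ _ _ _ dST (erefl R)) dCT_simple.
have sSR : S \subset R by apply: subsetUl.
have sTR : T \subset R by apply: subsetUr.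
rewrite (eq_bigl [predU S & T]) => [|i]; last by rewrite !inE.
rewrite bigU //=; congr (_ + _).
  apply: eq_bigr => s sS.
  have sT : s \notin T by rewrite (disjointFr dST).
  have sR : s \in R by rewrite (subsetP sSR).
  have R'E : S :\ s :|: T = R :\ s.
    by rewrite /R setDUl [T :\ s](setDidPl _) // disjoint_sym disjoints1.
  have dS'T : [disjoint S :\ s & T] := disjointWl (subsetDl _ _) dST.
  rewrite (mCT_simple _ _ _ _ dS'T R'E) (wmap_Hproj _ sR hq).
  rewrite Hproj_wmap ?setSD // -wedgeA.
  have [->|nz] := eqVneq (nuH (R :\ s) s) 0; first by rewrite linear0 !linear0l !simple0l.
  by rewrite bmap_Wincl // Wincl_bmap ?setSD // !inE eqxx.
rewrite scaler_sumr; apply: eq_bigr => t tT.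
have tS : t \notin S by rewrite (disjointFl dST).
have tR : t \in R by rewrite (subsetP sTR).
have R'E : S :|: T :\ t = R :\ t.
  by rewrite /R setDUl [S :\ t](setDidPl _) // disjoint_sym disjoints1.
have dST' : [disjoint S & T :\ t] := disjointWr (subsetDl _ _) dST.
rewrite (mCT_simple _ _ _ _ dST' R'E) (wmap_Hproj _ tR hq).
rewrite Hproj_wmap ?setSD // (wedge_extv_sign (ext_map_deg _ hq)) simpleZl.
have [->|nz] := eqVneq (nuH (R :\ t) t) 0.
  by rewrite linear0 !linear0l !linear0r !simple0l.
by rewrite bmap_Wincl // Wincl_bmap ?setSD // !inE eqxx.
Qed.

Lemma dCT_leibniz p q r a b : CTdeg p q r a ->
  dCT (mCT a b) = mCT (dCT a) b + (-1) ^+ q *: mCT a (dCT b).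
Proof.
move=> da; elim/CTdeg_ind: a / da => [c a a' IH IH'|S h w _ hq _|].
- rewrite !linearP !linearPl !linearP /= IH IH' !scalerDr !scalerA.
  by rewrite addrACA [c * _]mulrC.
- elim/CT_ind: b => [c b b' IH IH'|T k v]; last exact: dCT_leibniz_simple.
  rewrite linearP !linearPr linearP /= IH IH' !scalerDr !scalerA.
  by rewrite addrACA [c * _]mulrC.
by rewrite linear0 !linear0l linear0 scaler0 addr0.
Qed.

(** * The trigrading of the complex *)

Definition CS_part S q r : CS form nu S -> CS form nu S :=
  tlift (fun h w => tens (ext_part q h) (ext_part r w) : CS form nu S).

Lemma CS_part_tens S q r h w :
  @CS_part S q r (tens h w) = tens (ext_part q h) (ext_part r w).
Proof.
by apply: tlift_tens => [w' c x y|h' c x y]; rewrite linearP ?linearPl ?linearPr.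
Qed.

Definition CT_part p q r (a : CT) : CT :=
  dsum_of (fun S => if (#|S| + q == p)%N then CS_part q r (a S) else 0).

Lemma CT_partE p q r a S :
  CT_part p q r a S = if (#|S| + q == p)%N then CS_part q r (a S) else 0.
Proof. exact: ffunE. Qed.

Fact CT_part_is_linear p q r : linear (CT_part p q r).
Proof.
move=> c a b; apply/ffunP => S; rewrite dsumD dsumZ !CT_partE dsumD dsumZ.
by case: ifP => _; [rewrite /CS_part linearP | rewrite scaler0 addr0].
Qed.

Lemma CT_part_simple p q r S h w : CT_part p q r (simple (S := S) h w) =
  if (#|S| + q == p)%N then simple (ext_part q h) (ext_part r w) else 0.
Proof.
apply/ffunP => R; rewrite CT_partE; have [<-|nR] := eqVneq S R.
  by rewrite simple_same CS_part_tens; case: ifP => _; rewrite ?simple_same ?dsum0.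
rewrite simple_other // /CS_part linear0 if_same.
by case: ifP => _; rewrite ?simple_other ?dsum0.
Qed.

(** Bounds for all large [N] rather than for some [N], so that they can be
    combined for a sum of elements. *)
Lemma sum_CT_part a : exists N0, forall N, (N0 <= N)%N ->
  \sum_(p < N) \sum_(q < N) \sum_(r < N) CT_part p q r a = a.
Proof.
elim/CT_ind: a => [c a b [N IH] [N' IH']|S h w].
  exists (maxn N N') => M; rewrite geq_max => /andP[NM N'M].
  rewrite -[in RHS](IH M NM) -[in RHS](IH' M N'M).
  do 3![rewrite scaler_sumr -big_split; apply: eq_bigr => ? _ /=].
  exact: CT_part_is_linear.
exists (#|S| + \dim {:HS form nu S} + \dim {:WS nu S}).+1 => N leN.
have dHN : (\dim {:HS form nu S} < N)%N.
  by apply: leq_trans leN; rewrite ltnS -addnAC leq_addl.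
have dWN : (\dim {:WS nu S} < N)%N by apply: leq_trans leN; rewrite ltnS leq_addl.
rewrite exchange_big /= -[in RHS](sum_ext_part h dHN) /simple linear_sumlz linear_sum.
apply: eq_bigr => q _; rewrite -/(simple _ _).
transitivity (\sum_(r < N) simple (ext_part q h) (ext_part r w)); last first.
  by rewrite -[in RHS](sum_ext_part w dWN) /simple linear_sumr linear_sum.
have [SqN|NSq] := ltnP (#|S| + q) N.
  rewrite (bigD1 (Ordinal SqN)) //= [X in _ + X]big1 ?addr0 => [|p np].
    by apply: eq_bigr => r _; rewrite CT_part_simple eqxx.
  rewrite big1 // => r _; rewrite CT_part_simple ifN //.
  by move: np; rewrite -val_eqE eq_sym.
rewrite ext_part_gt; last first.
  rewrite -(ltn_add2l #|S|); apply: leq_trans NSq; apply: leq_trans leN.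
  by rewrite ltnS leq_addr.
rewrite [RHS]big1 => [|r _]; last exact: simple0l.
rewrite big1 // => p _; rewrite big1 // => r _; rewrite CT_part_simple ifN //.
by rewrite neq_ltn (leq_trans (ltn_ord p) NSq) orbT.
Qed.

Lemma CT_projectors : is_projectors CTdeg CT_part.
Proof.
split=> [|p q r a|p q r p' q' r' a da|a].
- exact: CT_part_is_linear.
- elim/CT_ind: a => [c a b da db|S h w].
    by rewrite CT_part_is_linear; apply: CTdegP.
  rewrite CT_part_simple; case: eqP => [Sp|_]; last exact: CTdeg0.
  by apply: CTdeg_simple; rewrite ?ext_part_deg.
- elim/CTdeg_ind: a / da => [c a b IH IH'|S h w Sp hq wr|].
  + rewrite CT_part_is_linear IH IH'; case: ifP => // _.
    by rewrite scaler0 addr0.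
  + rewrite CT_part_simple (ext_part_homog _ hq) (ext_part_homog _ wr) -Sp [p == _]eq_sym.
    have [->|_] := eqVneq q q'; last by rewrite simple0l if_same andbF.
    by have [_|_] := eqVneq r r'; rewrite ?andbT ?andbF // simple0r if_same.
  + by rewrite (linear_map0 (CT_part_is_linear p q r)) if_same.
by have [N NE] := sum_CT_part a; exists N; rewrite NE.
Qed.

Lemma CT_tridga (char0 : [pchar K] =i pred0) : is_tridga CTdeg mCT (oneCT form nu) dCT.
Proof.
split=> [|||a|p q r a b da].
- split.
  + exact: projectors_trigrading CT_projectors.
  + by move=> b c a a'; apply: linearPl.
  + by move=> a c b b'; apply: linearPr.
  + exact: mCT_assoc.
  + exact: mCT_1l.
  + exact: mCT_1r.
  + exact: oneCT_deg.
  + by move=> *; apply: mCT_deg.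
- exact: linearP.
- exact: dCT_deg.
- exact: dCT_sq.
- exact: dCT_leibniz da.
Qed.

End Complex.

Theorem proposition2p7 (K : fieldType) (V : vectType K)
    (form : {symmetric V}) (n : nat) (nu : 'I_n -> V)
    (char0 : [pchar K] =i pred0)
    (form_nondeg : nondegenerate form)
    (H_nondeg : forall S : {set 'I_n}, nondegenerate_on form (Hsp form nu S))
    (W_nondeg : forall (S : {set 'I_n}) (s : 'I_n), s \in S ->
       nondegenerate_on (@stdform K n) (Wsp nu (S :\ s))) :
  is_tridga (@CTdeg K V form n nu) (@mCT K V form n nu) (oneCT form nu)
    (dCT form nu) /\
  exists (mul : HCT form nu -> HCT form nu -> HCT form nu) (one : HCT form nu),
    [/\ forall x y : cycle_space (dCT form nu), exists2 z : cycle_space (dCT form nu),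
          vsval z = mCT (vsval x) (vsval y) &
          mul (hclass x) (hclass y) = hclass z,
        exists2 e : cycle_space (dCT form nu),
          vsval e = oneCT form nu & one = hclass e &
        is_trigraded_algebra (@HCTdeg K V form n nu) mul one].
Proof.
have prP := CT_projectors form nu; have dgaP := CT_tridga H_nondeg W_nondeg char0.
split=> //; exists (Hmul (mCT (nu := nu))), (hclass (cycle_of _ (oneCT form nu))).
split.
- move=> x y; exists (cycle_of (dCT form nu) (mCT (vsval x) (vsval y))).
    by rewrite val_cycle_of // (mul_cycle prP dgaP) // d_cycle.
  exact: (Hmul_hclass prP dgaP).
- by exists (cycle_of (dCT form nu) (oneCT form nu)); rewrite // val_cycle_of // (d_one dgaP).
exact: (homology_trigraded_algebra prP dgaP).
Qed.
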